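(* For a front $F$ with index $i$ and parameters $x,y,p,q,r,s,t$, let $$FI_3(F;x,y,p,q,r,s,t)=\big\langle x[XYXYZZ]+y[XXYYZZ]+p[XKXYY]+q[KXXYY]+r[XKYXY]+s[XXKK]+t[KKK],\;w_F\big\rangle+i .$$ Then $FI_3$ is an invariant of fronts: its value does not depend on the choice of the base point used to form $w_F$ and is unchanged under plane isotopy.
   Context: A front is the (generic) projection to $\mathbf{R}^2$ of an oriented closed immersed Legendrian curve in the space of cooriented contact elements of the plane: an oriented closed plane curve whose only singularities are transversal double points and semicubical cusps, with a coorientation, i.e. a continuous choice (also through cusps) of a unit normal to the tangent line. A base point is a point of the front that is neither a double point nor a cusp. The index $i$ is the number of counterclockwise full rotations of the coorienting normal when going once along the front. With a base point chosen, $w_F$ is the word obtained by labelling double points and cusps by distinct letters and reading them along $F$ from the base point; double point letters occur twice, cusp letters once. For a double point $A$ with tangent vectors $t_1,t_2$ at the first and second passage, $\mathrm{sign}\,A=+1$ if $(t_1,t_2)$ is a negatively oriented frame, $-1$ otherwise. For a cusp $K$, $\mathrm{sign}\,K=-1$ if the front turns to the left at $K$ (the outgoing branch lies to the left of the incoming branch), $+1$ if it turns to the right. In pattern words, $X,Y,Z$ occur twice and stand for double points, each occurrence of $K$ stands for a separate cusp letter. $\langle v,w_F\rangle=\sum_{v'}\prod_{A\in v'}\mathrm{sign}\,A$, the sum over all sub-words $v'$ of $w_F$ (choose a subset of letters, delete the others) equal to $v$ up to bijective renaming of letters, the product over the distinct letters of $v'$; extend linearly in $v$. Cyclic equivalence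 for fronts is the equivalence relation on signed pattern words generated by $Ax\sim -xA$ if the first letter $A$ is a double point letter and $Kx\sim xK$ if the first letter $K$ is a cusp letter; $[v]$ stands for the sum of all signed elements of the class of $v$ (words up to renaming). Explicitly, $$[XYXYZZ]=XYXYZZ-YXYZZX+XYZZXY-YZZXYX+ZZXYXY-ZXYXYZ,$$ $$[XXYYZZ]=XXYYZZ-XYYZZX,$$ $$[XKXYY]=XKXYY-KXYYX-XYYXK+YYXKX-YXKXY,$$ $$[KXXYY]=KXXYY+XXYYK-XYYKX+YYKXX-YKXXY,$$ $$[XKYXY]=XKYXY-KYXYX-YXYXK+XYXKY-YXKYX,$$ $$[XXKK]=XXKK-XKKX+KKXX+KXXK,\qquad [KKK]=KKK.$$ *)

(* Defs.v *)
From HB Require Import structures.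
From mathcomp Require Import all_boot all_order all_algebra.
From mathcomp Require Import finmap.
From mathcomp Require Import all_classical all_reals all_analysis.

Set Implicit Arguments.
Unset Strict Implicit.
Unset Printing Implicit Defensive.
Import Order.TTheory GRing.Theory Num.Theory.
Import numFieldNormedType.Exports.
Local Open Scope classical_set_scope.
Local Open Scope ring_scope.

(** * Words and the pairing *)

Definition renaming (T U : eqType) (v : seq T) (w : seq U) : Prop :=
  exists f : T -> U, {in v &, injective f} /\ w = map f v.

(** [<v, w>]: [S] ranges over the sets of letters of [w]; the letters outside
    [S] are deleted. *)
Definition pairing (T : choiceType) (sgn : T -> int) (v : seq nat) (w : seq T)
    : int :=
  \sum_(S <- fpowerset [fset a | a in w]%fset
         | `[< renaming v [seq a <- w | a \in S] >]) \prod_(a <- S) sgn a.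

(** Pattern words are words in natural numbers.  In such a word a letter which
    occurs twice is a double point letter, a letter which occurs once is a cusp
    letter.  A signed word is a pair of a coefficient and a word. *)
Definition swrd : Type := (int * seq nat)%type.

Definition rotate1 (u : swrd) : swrd :=
  if u.2 is a :: x then ((if a \in x then - u.1 else u.1), rcons x a) else u.

Inductive cyc_equiv : swrd -> swrd -> Prop :=
| cyc_rotate u : cyc_equiv u (rotate1 u)
| cyc_rename e v w : renaming v w -> cyc_equiv (e, v) (e, w)
| cyc_refl u : cyc_equiv u u
| cyc_sym u v : cyc_equiv u v -> cyc_equiv v u
| cyc_trans u v w : cyc_equiv u v -> cyc_equiv v w -> cyc_equiv u w.

(** The representative of a word up to renaming: each letter is replaced by the
    position of its first occurrence. *)
Definition canon (v : seq nat) : seq nat := [seq index a v | a <- v].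

(** [[v]], as the list of its terms.  Rotating a word twice its length many times
    restores the signed word, so the trajectory is the whole class (see
    [bracketP]). *)
Definition bracket (v : seq nat) : seq swrd :=
  undup (traject (fun u => let u' := rotate1 u in (u'.1, canon u'.2))
                 (1, canon v) (size v).*2.+1).

Lemma renaming_canon (v : seq nat) : renaming v (canon v).
Proof.
exists (index^~ v); split => // a b va vb eab.
by rewrite -(nth_index 0 va) eab nth_index.
Qed.

Lemma canon_renaming (v w : seq nat) : renaming v w -> canon v = canon w.
Proof.
case=> f [finj ->]; rewrite /canon -map_comp; apply/eq_in_map => a va /=.
suff H : forall s, {subset s <= v} -> index a s = index (f a) (map f s) by exact: H.
elim=> [|b s IH] sv //=; rewrite -IH; last by move=> c cs; apply: sv; rewrite inE cs orbT.
case: (eqVneq b a) => [->|ba]; first by rewrite eqxx.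
case: (eqVneq (f b) (f a)) => // /finj eba.
by rewrite eba ?eqxx // in ba; apply: sv; rewrite inE eqxx.
Qed.

Definition nf (u : swrd) : swrd := (u.1, canon u.2).

Lemma nf_rename (u v : swrd) : nf u = nf v <-> u.1 = v.1 /\ renaming u.2 v.2.
Proof.
split=> [[-> E]|[E1 /canon_renaming E2]]; last by rewrite /nf E1 E2.
split=> //; have [f [finj Ef]] := renaming_canon u.2.
have Es : size u.2 = size v.2 by have := congr1 size E; rewrite !size_map.
exists (fun a => nth 0 v.2 (index a u.2)); split=> [a b au bu|].
  have h c : c \in u.2 -> index (nth 0 v.2 (index c u.2)) v.2 = index c u.2.
    move=> cu; have := congr1 (nth 0 ^~ (index c u.2)) E.
    by rewrite !(nth_map 0) -?Es ?index_mem // nth_index // => <-.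
  by move=> /(congr1 (index^~ v.2)); rewrite !h // => /(congr1 (nth 0 u.2)); rewrite !nth_index.
apply: (@eq_from_nth _ 0); rewrite ?size_map // => i iu.
rewrite (nth_map 0) ?Es //; have := congr1 (nth 0 ^~ i) E.
by rewrite !(nth_map 0) ?Es // => ->; rewrite nth_index // mem_nth.
Qed.

Lemma nf_rotate1 (u v : swrd) : nf u = nf v -> nf (rotate1 u) = nf (rotate1 v).
Proof.
case: u v => [e v] [e' w] /nf_rename[/= <- [f [finj ->]]] {e' w}.
apply/nf_rename; case: v finj => [|a x] finj; rewrite /rotate1 /=.
  by split=> //; exists id.
have -> : (f a \in map f x) = (a \in x).
  apply/mapP/idP => [[b bx /finj E]|ax]; last by exists a.
  by rewrite E // inE ?eqxx // bx orbT.
split=> //; exists f; split; last by rewrite map_rcons.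
by move=> b c; rewrite !mem_rcons; apply: finj.
Qed.

Lemma nf_iter k (u v : swrd) :
  nf u = nf v -> nf (iter k rotate1 u) = nf (iter k rotate1 v).
Proof. by move=> E; elim: k => //= k; apply: nf_rotate1. Qed.

Lemma iter_rotate1 (v : seq nat) k : (k <= size v)%N -> exists c : int,
  c * c = 1 /\ forall e, iter k rotate1 (e, v) = (e * c, rot k v).
Proof.
elim: k => [|k IH] kv; first by exists 1; split=> // e; rewrite mulr1 rot0.
have [c [cc H]] := IH (ltnW kv).
have E : rot k v = nth 0 v k :: (drop k.+1 v ++ take k v).
  by rewrite /rot (drop_nth 0).
have E' : rot k.+1 v = rcons (drop k.+1 v ++ take k v) (nth 0 v k).
  by rewrite /rot (take_nth 0) // rcons_cat.
exists (if nth 0 v k \in drop k.+1 v ++ take k v then - c else c).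
split=> [|e]; first by case: ifP; rewrite ?mulrNN.
by rewrite iterS H /rotate1 /= E E'; case: ifP; rewrite ?mulrN.
Qed.

Lemma rotate1_period (u : swrd) : iter (size u.2).*2 rotate1 u = u.
Proof.
case: u => e v /=; rewrite -addnn iterD.
have [c [cc H]] := iter_rotate1 (leqnn (size v)).
by rewrite H rot_size H rot_size -mulrA cc mulr1.
Qed.

Lemma rotate1_return (u : swrd) k :
  exists2 m, (m <= (size u.2).*2)%N & iter k rotate1 u = iter m rotate1 u.
Proof.
elim: k => [|k [m mu E]]; first by exists 0%N.
move: mu; rewrite leq_eqVlt => /orP[/eqP mu|mu]; last by exists m.+1 => //=; rewrite E.
have Eu : iter k rotate1 u = u by rewrite E mu rotate1_period.
case: (posnP (size u.2).*2) => [s0|s0]; last by exists 1%N => //; rewrite iterS Eu.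
exists 0%N => //; rewrite iterS Eu; move/eqP: s0; rewrite double_eq0 size_eq0.
by case: {mu Eu E} u => e [].
Qed.

Lemma rotate1_back (u : swrd) k : exists m, iter m rotate1 (iter k rotate1 u) = u.
Proof.
have [m mu ->] := rotate1_return u k.
exists ((size u.2).*2 - m)%N; rewrite -iterD subnK //; exact: rotate1_period.
Qed.

Lemma cyc_iter (u w : swrd) :
  cyc_equiv u w <-> exists k, nf w = nf (iter k rotate1 u).
Proof.
split=> [|[k E]].
  elim=> {u w} [u|e v w vw|u|u v _ [k E]|u v w _ [k Ek] _ [m Em]].
  - by exists 1%N.
  - by exists 0%N; apply/esym/nf_rename.
  - by exists 0%N.
  - by have [m Em] := rotate1_back u k; exists m; rewrite (nf_iter m E) Em.
  - by exists (m + k)%N; rewrite iterD Em; apply: nf_iter.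
suff cu m : cyc_equiv u (iter m rotate1 u).
  apply: (cyc_trans (cu k)); have /nf_rename := esym E.
  by case: (iter k rotate1 u) w {E} => [e v] [e' w] /= [<- ?]; apply: cyc_rename.
elim: m => [|m IH]; [exact: cyc_refl | exact: (cyc_trans IH (cyc_rotate _))].
Qed.

Lemma canonK (v : seq nat) : canon (canon v) = canon v.
Proof. exact/esym/canon_renaming/renaming_canon. Qed.

Lemma bracketP (v : seq nat) (u : swrd) :
  u \in bracket v <-> cyc_equiv (1, v) u /\ u.2 = canon u.2.
Proof.
rewrite mem_undup; set g := (X in traject X).
have gE k : iter k g (1, canon v) = nf (iter k rotate1 (1, v)).
  elim: k => //= k ->; rewrite /g /= -/(nf _); apply: nf_rotate1.
  by rewrite /nf /= canonK.
split=> [/trajectP[k _ ->]|[/cyc_iter[k E] un]].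
  rewrite gE /= canonK; split=> //; apply/cyc_iter; exists k.
  by rewrite /nf /= canonK.
apply/trajectP; have [m mv Em] := rotate1_return (1, v) k.
by exists m; rewrite // gE -Em -E /nf -un; case: u {E un}.
Qed.

Local Notation X := 0%N.
Local Notation Y := 1%N.
Local Notation Z := 2%N.
Local Notation K1 := 3%N.
Local Notation K2 := 4%N.
Local Notation K3 := 5%N.

Local Notation "+: w" := ((1 : int), canon w) (at level 60).
Local Notation "-: w" := (- (1 : int), canon w) (at level 60).

Lemma bracket_XYXYZZ : perm_eq (bracket [:: X; Y; X; Y; Z; Z])
  [:: +: [:: X; Y; X; Y; Z; Z]; -: [:: Y; X; Y; Z; Z; X];
      +: [:: X; Y; Z; Z; X; Y]; -: [:: Y; Z; Z; X; Y; X];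
      +: [:: Z; Z; X; Y; X; Y]; -: [:: Z; X; Y; X; Y; Z]].
Proof. by vm_compute. Qed.

Lemma bracket_XXYYZZ : perm_eq (bracket [:: X; X; Y; Y; Z; Z])
  [:: +: [:: X; X; Y; Y; Z; Z]; -: [:: X; Y; Y; Z; Z; X]].
Proof. by vm_compute. Qed.

Lemma bracket_XKXYY : perm_eq (bracket [:: X; K1; X; Y; Y])
  [:: +: [:: X; K1; X; Y; Y]; -: [:: K1; X; Y; Y; X]; -: [:: X; Y; Y; X; K1];
      +: [:: Y; Y; X; K1; X]; -: [:: Y; X; K1; X; Y]].
Proof. by vm_compute. Qed.

Lemma bracket_KXXYY : perm_eq (bracket [:: K1; X; X; Y; Y])
  [:: +: [:: K1; X; X; Y; Y]; +: [:: X; X; Y; Y; K1]; -: [:: X; Y; Y; K1; X];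
      +: [:: Y; Y; K1; X; X]; -: [:: Y; K1; X; X; Y]].
Proof. by vm_compute. Qed.

Lemma bracket_XKYXY : perm_eq (bracket [:: X; K1; Y; X; Y])
  [:: +: [:: X; K1; Y; X; Y]; -: [:: K1; Y; X; Y; X]; -: [:: Y; X; Y; X; K1];
      +: [:: X; Y; X; K1; Y]; -: [:: Y; X; K1; Y; X]].
Proof. by vm_compute. Qed.

Lemma bracket_XXKK : perm_eq (bracket [:: X; X; K1; K2])
  [:: +: [:: X; X; K1; K2]; -: [:: X; K1; K2; X]; +: [:: K1; K2; X; X];
      +: [:: K1; X; X; K2]].
Proof. by vm_compute. Qed.

Lemma bracket_KKK : bracket [:: K1; K2; K3] = [:: +: [:: K1; K2; K3]].
Proof. by vm_compute. Qed.

(** * Fronts *)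

(** Infinitely differentiable maps: all iterated directional derivatives are
    differentiable. *)
Fixpoint ndiff (R : realType) (V W : normedModType R) (k : nat) (f : V -> W)
    : Prop :=
  (forall x, differentiable f x) /\
  (if k is k'.+1 then forall v, ndiff k' (fun x => 'D_v f x) else True).

Definition smooth (R : realType) (V W : normedModType R) (f : V -> W) : Prop :=
  forall k, ndiff k f.

Notation plane R := (R * R)%type.

Section Plane.
Variable R : realType.

Definition dot (u v : plane R) : R := u.1 * v.1 + u.2 * v.2.
Definition det2 (u v : plane R) : R := u.1 * v.2 - u.2 * v.1.

(** A closed curve is a 1-periodic map; [same_param s t] says that [s] and [t]
    are the same point of the circle [R / Z]. *)
Definition same_param (s t : R) : Prop := exists k : int, s = t + k%:~R.

Definition cusp (g : R -> plane R) (t : R) : Prop := derive1 g t = 0.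

Definition double (g : R -> plane R) (t : R) : Prop :=
  exists s, ~ same_param s t /\ g s = g t.

(** A direction vector of the tangent line; at a semicubical cusp the velocity
    vanishes and the tangent line is spanned by the second derivative. *)
Definition tangent (g : R -> plane R) (t : R) : plane R :=
  if `[< cusp g t >] then derive1n 2 g t else derive1 g t.

Record front := Front {
  curve : R -> plane R;
  coor : R -> plane R;
  curve_smooth : smooth curve;
  curve_periodic : forall t, curve (t + 1) = curve t;
  curve_semicubical : forall t, cusp curve t ->
    det2 (derive1n 2 curve t) (derive1n 3 curve t) != 0;
  curve_transversal : forall s t, ~ same_param s t -> curve s = curve t ->
    det2 (derive1 curve s) (derive1 curve t) != 0;
  curve_no_triple : forall s t u, curve s = curve t -> curve t = curve u ->
    [\/ same_param s t, same_param t u | same_param s u];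
  coor_continuous : continuous coor;
  coor_periodic : forall t, coor (t + 1) = coor t;
  coor_unit : forall t, dot (coor t) (coor t) = 1;
  coor_normal : forall t, dot (coor t) (tangent curve t) = 0
}.

Definition singular (F : front) (t : R) : Prop :=
  cusp (curve F) t \/ double (curve F) t.

(** A base point is given by a parameter. *)
Definition base_point (F : front) (b : R) : Prop := ~ singular F b.

(** [i] is the total variation of the angle of the normal along one period,
    in full turns. *)
Definition is_index (F : front) (i : int) : Prop :=
  exists theta : R -> R, [/\ continuous theta,
    forall t, coor F t = (cos (theta t), sin (theta t)) &
    forall t, theta (t + 1) = theta t + i%:~R * (2 * pi)].

Definition index_front (F : front) : int := xget 0 (is_index F).

(** The parameters of the double points and the cusps met along [F] from the
    base point, in order; there are finitely many of them since the circle is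
    compact and the singularities are isolated. *)
Definition sing_times (F : front) (b : R) : seq R :=
  sort (fun s t => s <= t)
    (fset_set [set t | b < t < b + 1 /\ singular F t]).

(** The letters are the double points and the cusps themselves, as points of
    the plane. *)
Definition front_word (F : front) (b : R) : seq (plane R) :=
  [seq curve F t | t <- sing_times F b].

(** The point [curve F (t + h)] of the outgoing branch lies to the left of the
    line directed from the point [curve F (t - h)] of the incoming branch to
    the cusp. *)
Definition turns_left (F : front) (t : R) : Prop :=
  \forall h \near 0^'+,
    0 < det2 (curve F t - curve F (t - h)) (curve F (t + h) - curve F (t - h)).

(** Two passages: a double point; one passage: a cusp. *)
Definition letter_sign (F : front) (b : R) (A : plane R) : int :=
  match [seq t <- sing_times F b | curve F t == A] with
  | [:: s1, s2 & _] =>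
      if det2 (derive1 (curve F) s1) (derive1 (curve F) s2) < 0 then 1 else -1
  | [:: s] => if `[< turns_left F s >] then -1 else 1
  | [::] => 0
  end.

(** [<[v], w_F>] *)
Definition front_pairing (F : front) (b : R) (v : seq nat) : int :=
  \sum_(u <- bracket v) u.1 * pairing (letter_sign F b) u.2 (front_word F b).

Definition FI3 (A : comNzRingType) (F : front) (b : R) (x y p q r s t : A)
    : A :=
  x * (front_pairing F b [:: X; Y; X; Y; Z; Z])%:~R
  + y * (front_pairing F b [:: X; X; Y; Y; Z; Z])%:~R
  + p * (front_pairing F b [:: X; K1; X; Y; Y])%:~R
  + q * (front_pairing F b [:: K1; X; X; Y; Y])%:~R
  + r * (front_pairing F b [:: X; K1; Y; X; Y])%:~R
  + s * (front_pairing F b [:: X; X; K1; K2])%:~R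
  + t * (front_pairing F b [:: K1; K2; K3])%:~R
  + (index_front F)%:~R.

Definition diffeomorphism (f : plane R -> plane R) : Prop :=
  smooth f /\ exists g, [/\ smooth g, cancel f g & cancel g f].

(** [Phi (tau, .)], for [tau] from 0 to 1, is an isotopy starting at the
    identity. *)
Definition ambient_isotopy (Phi : R * plane R -> plane R) : Prop :=
  [/\ smooth Phi, forall z, Phi (0, z) = z &
      forall tau, 0 <= tau <= 1 -> diffeomorphism (fun z => Phi (tau, z))].

(** Orientation preserving diffeomorphisms of the circle, lifted to the line. *)
Definition reparametrization (sigma : R -> R) : Prop :=
  [/\ smooth sigma, forall t, sigma (t + 1) = sigma t + 1 &
      forall t, 0 < derive1 sigma t].

(** [F'] is the image of [F] under [f], as an oriented cooriented curve: the
    differential of [f] carries the coorienting side of [F] to the coorienting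
    side of [F'].  Fronts are considered up to reparametrization. *)
Definition front_image (f : plane R -> plane R) (F F' : front) : Prop :=
  exists sigma, [/\ reparametrization sigma,
    forall t, curve F' t = f (curve F (sigma t)) &
    forall t, 0 < dot (coor F' t) ('D_(coor F (sigma t)) f (curve F (sigma t)))].

Definition plane_isotopic (F F' : front) : Prop :=
  exists Phi, ambient_isotopy Phi /\ front_image (fun z => Phi (1, z)) F F'.

End Plane.

(* Main.v *)
From mathcomp Require Import all_boot all_order all_algebra.
From mathcomp Require Import finmap.
From mathcomp Require Import all_classical all_reals all_analysis.
From mathcomp Require Import ring lra.
Require Import Defs.

(** Both parts of the invariant are treated separately: the seven pairings with
    the word of the front, and the index.

    The pairing with a class [[v]] does not see the base point.  When the base
    point passes over the first letter of the word, the word is rotated.  The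
    coefficient in [[v]] of a sub-word containing the moved letter changes by the
    sign of the cyclic equivalence, which is -1 exactly for the letter of a double
    point ([class_coef_rotate]).  At the same time the order of the two passages
    through this double point is exchanged, so the frame of the two tangents
    changes orientation and the sign of the letter changes too
    ([letter_sign_cut]).  The two changes cancel in every term of the pairing
    ([bracket_pairing_rot], [front_pairing_base]).

    An isotopy ends with a diffeomorphism [f] of positive Jacobian, because the
    Jacobian is 1 at the start and never vanishes ([isotopy_jacobian_gt0]).  So
    [f] carries double points to double points and cusps to cusps, in the same
    order, and keeps the orientations of the frames at the double points.  The
    side to which a cusp turns is the sign of the determinant of the second and
    third derivatives of the curve ([turns_left_det]); at a cusp the velocity
    vanishes, hence the higher derivatives of [f] do not contribute to these two
    derivatives of the image ([jet3_comp_critical]) and this sign is kept as well.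
    Therefore the image has the same word and the same signs ([image_pairing]).

    For the index, the coorientation of the image is, up to a positive factor, the
    image of the original conormal covector under the inverse transpose of the
    differential ([conormal_direction]).  Along the isotopy these fields form a
    homotopy through nowhere zero periodic fields from the coorientation of the
    front to that of its image ([image_index]), and homotopic fields have the same
    winding numbers ([winding_homotopy]). *)

Set Implicit Arguments.
Unset Strict Implicit.
Unset Printing Implicit Defensive.
Import Order.TTheory GRing.Theory Num.Theory.
Import numFieldNormedType.Exports.
Local Open Scope classical_set_scope.
Local Open Scope ring_scope.

(** * Signed cyclic classes of words *)

(** For words in natural numbers this is [canon]; the letters of a front are points
    of the plane. *)
Definition pattern (T : eqType) (w : seq T) : seq nat := [seq index a w | a <- w].

Lemma pattern_map (T U : eqType) (f : T -> U) (w : seq T) :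
  {in w &, injective f} -> pattern (map f w) = pattern w.
Proof.
move=> finj; rewrite /pattern -map_comp; apply/eq_in_map => a wa /=.
suff H s : {subset s <= w} -> index (f a) (map f s) = index a s by exact: H.
elim: s => [|b s IH] sw //=.
rewrite IH; last by move=> c cs; apply: sw; rewrite inE cs orbT.
by rewrite (inj_in_eq finj) // sw // mem_head.
Qed.

Lemma renaming_pattern (T : eqType) (w : seq T) : renaming w (pattern w).
Proof.
exists (index^~ w); split => // a b wa wb eab.
by rewrite -(nth_index a wa) eab nth_index.
Qed.

Lemma renaming_eq_pattern (T U : eqType) (v : seq T) (w : seq U) :
  renaming v w -> pattern v = pattern w.
Proof. by case=> f [finj ->]; rewrite pattern_map. Qed.

Lemma pattern_renaming (T U : eqType) (c : U) (v : seq T) (w : seq U) :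
  pattern v = pattern w -> renaming v w.
Proof.
move=> E; have sz : size v = size w by have := congr1 size E; rewrite !size_map.
exists (fun a => nth c w (index a v)); split=> [a b av bv|].
  have h d : d \in v -> index (nth c w (index d v)) w = index d v.
    move=> dv; have := congr1 (nth 0%N ^~ (index d v)) E.
    by rewrite (nth_map d) ?index_mem // (nth_map c) -?sz ?index_mem // nth_index // => <-.
  by move=> /(congr1 (index^~ w)); rewrite !h // => /(congr1 (nth a v)); rewrite !nth_index.
apply: (@eq_from_nth _ c); rewrite ?size_map // => i iw.
case: v => [|a v] in E sz *; first by rewrite -sz in iw.
rewrite (nth_map a) ?sz //; have := congr1 (nth 0%N ^~ i) E.
by rewrite (nth_map a) ?sz // (nth_map c) // => ->; rewrite nth_index // mem_nth.
Qed.

Lemma pattern_idem (T : eqType) (w : seq T) : canon (pattern w) = pattern w.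
Proof. exact: esym (renaming_eq_pattern (renaming_pattern w)). Qed.

Lemma cyc_equiv_sqr u w : cyc_equiv u w -> u.1 * u.1 = w.1 * w.1.
Proof.
elim=> {u w} [[e [|a x]]|||u w _ ->|u v w _ -> _ ->] //.
by rewrite /rotate1 /=; case: ifP => // _; rewrite mulrNN.
Qed.

Lemma bracket_sign v u : u \in bracket v -> u.1 = 1 \/ u.1 = -1.
Proof.
case/bracketP => /cyc_equiv_sqr /= E _.
have : u.1 ^+ 2 == 1 ^+ 2 by rewrite !expr2 -E.
by rewrite eqf_sqr => /orP[/eqP|/eqP]; [left|right].
Qed.

(** The sum [[v]] seen as a function on words: the pairing with [[v]] then becomes a
    single sum over sub-words, see [bracket_pairingE]. *)
Definition class_coef (v n : seq nat) : int :=
  \sum_(u <- bracket v | u.2 == n) u.1.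

Lemma class_coefE v n :
  class_coef v n = ((1, n) \in bracket v)%:R - ((- 1, n) \in bracket v)%:R.
Proof.
have mem e : (((e, n) \in bracket v)%:R : int) = \sum_(u <- bracket v) (u == (e, n))%:R.
  rewrite -count_uniq_mem ?undup_uniq // -sum1_count natr_sum big_mkcond /=.
  by apply: eq_bigr => u _; case: eqP.
rewrite !mem -sumrB /class_coef big_mkcond; apply: eq_big_seq => -[e m].
by case/bracket_sign => /= ->; rewrite !xpair_eqE; case: (m == n).
Qed.

Lemma bracket_rotate v e (T : eqType) (a : T) x :
  ((e, pattern (a :: x)) \in bracket v) =
  ((if a \in x then - e else e, pattern (rcons x a)) \in bracket v).
Proof.
pose z := rotate1 (e, pattern (a :: x)).
have [f [finj Ef]] := renaming_pattern (a :: x).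
have z1 : z.1 = if a \in x then - e else e.
  rewrite /z Ef /rotate1 /=; suff -> : (f a \in map f x) = (a \in x) by [].
  apply/mapP/idP => [[b bx /finj E]|ax]; last by exists a.
  by rewrite E // inE ?eqxx // bx orbT.
have z2 : canon z.2 = pattern (rcons x a).
  have -> : z.2 = map f (rcons x a) by rewrite /z Ef /rotate1 /= map_rcons.
  by apply: pattern_map => b c; rewrite !mem_rcons; apply: finj.
have zn : cyc_equiv z (z.1, pattern (rcons x a)).
  rewrite -z2; case: (z) => c w /=; apply: cyc_rename; exact: renaming_canon.
have rz : cyc_equiv (e, pattern (a :: x)) z by apply: cyc_rotate.
rewrite -z1; apply/idP/idP => /bracketP[E _]; apply/bracketP; rewrite /= pattern_idem.
  by split=> //; apply: cyc_trans E (cyc_trans rz zn).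
by split=> //; apply: cyc_trans E (cyc_trans (cyc_sym zn) (cyc_sym rz)).
Qed.

(** Cyclic equivalence maps the class of [v] bijectively to itself, and its sign
    depends only on whether the moved letter occurs again. *)
Lemma class_coef_rotate v (T : eqType) (a : T) x :
  class_coef v (pattern (rcons x a)) =
  (if a \in x then - 1 else 1) * class_coef v (pattern (a :: x)).
Proof.
rewrite !class_coefE !bracket_rotate; case: ifP => _; last by rewrite mul1r.
by rewrite opprK mulN1r opprB.
Qed.

(** * The bracket pairing *)

Definition bracket_pairing (T : choiceType) (sgn : T -> int) (v : seq nat)
    (w : seq T) : int :=
  \sum_(u <- bracket v) u.1 * pairing sgn u.2 w.

Lemma bracket_pairingE (T : pointedType) (sgn : T -> int) v (w : seq T) :
  bracket_pairing sgn v w =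
  \sum_(S <- fpowerset [fset a | a in w]%fset)
     class_coef v (pattern [seq a <- w | a \in S]) * \prod_(a <- S) sgn a.
Proof.
rewrite /bracket_pairing /pairing.
under eq_bigr => u _ do rewrite mulr_sumr.
rewrite (exchange_big_dep predT) //=; apply: eq_bigr => S _.
rewrite mulr_suml /class_coef big_mkcond [RHS]big_mkcond.
apply: eq_big_seq => u /bracketP[_ un].
suff -> : `[< renaming u.2 [seq a <- w | a \in S] >] =
          (u.2 == pattern [seq a <- w | a \in S]) by [].
apply/asboolP/eqP => [/renaming_eq_pattern <-|E]; first by rewrite {1}un.
by apply: (pattern_renaming point); rewrite -E [RHS]un.
Qed.

Lemma eq_bracket_pairing (T : pointedType) (sgn sgn' : T -> int) v (w : seq T) :
  {in w, sgn =1 sgn'} -> bracket_pairing sgn v w = bracket_pairing sgn' v w.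
Proof.
move=> E; rewrite !bracket_pairingE; apply: eq_big_seq => S.
rewrite fpowersetE => /fsubsetP SL; congr (_ * _); apply: eq_big_seq => a /SL.
by rewrite !inE => /E.
Qed.

(** The sets of letters of [map f w] are the images of those of [w]. *)
Lemma bracket_pairing_map (T U : pointedType) (f : T -> U) (sgn : T -> int)
    (sgn' : U -> int) v (w : seq T) :
  injective f -> {in w, forall a, sgn' (f a) = sgn a} ->
  bracket_pairing sgn' v (map f w) = bracket_pairing sgn v w.
Proof.
move=> finj fs; rewrite !bracket_pairingE.
pose im (S : {fset T}) : {fset U} := (f @` S)%fset.
have -> : fpowerset [fset a | a in map f w]%fset =
          [fset im S | S in fpowerset [fset a | a in w]]%fset.
  apply/fsetP => B; rewrite fpowersetE; apply/fsubsetP/imfsetP => /= [BL|[S]].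
    exists [fset a in w | f a \in B]%fset.
      by rewrite fpowersetE; apply/fsubsetP => a; rewrite !inE => /andP[].
    apply/fsetP => b; apply/idP/imfsetP => /= [bB|[a]]; last by rewrite !inE => /andP[_ ?] ->.
    have := BL b bB; rewrite inE => /mapP[a aw E]; exists a => //.
    by rewrite !inE aw -E.
  rewrite fpowersetE => /fsubsetP SL -> b /imfsetP[/= a /SL]; rewrite !inE => aw ->.
  exact: map_f.
rewrite big_imfset /=; last first.
  move=> S S' _ _ E; apply/fsetP => a.
  have mem (S0 : {fset T}) : (f a \in im S0) = (a \in S0) by rewrite mem_imfset.
  by rewrite -!mem E.
apply: eq_big_seq => S; rewrite fpowersetE => /fsubsetP SL.
congr (class_coef v _ * _); last first.
  rewrite big_imfset /=; last by move=> ? ? _ _; apply: finj.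
  by apply: eq_big_seq => a /SL; rewrite inE => /fs.
rewrite filter_map pattern_map; last by move=> ? ? _ _; apply: finj.
congr pattern; apply: eq_filter => a /=; by rewrite mem_imfset.
Qed.

(** In a term whose sub-word contains [a] at least twice, the sign of the rotation and the
    new sign of [a] cancel; the other terms are unchanged. *)
Lemma bracket_pairing_rotate1 (T : pointedType) (sgn : T -> int) v a (x : seq T) :
  bracket_pairing sgn v (a :: x) =
  bracket_pairing (fun b => if (b == a) && (b \in x) then - sgn b else sgn b) v (rcons x a).
Proof.
rewrite !bracket_pairingE.
have -> : [fset b | b in rcons x a]%fset = [fset b | b in a :: x]%fset.
  by apply/fsetP => b; rewrite !inE mem_rcons.
apply: eq_bigr => S _; rewrite filter_rcons /=; case: ifP => aS; last first.
  congr (_ * _); apply: eq_big_seq => b bS; case: eqP => // E.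
  by rewrite -E bS in aS.
rewrite class_coef_rotate mem_filter aS /=.
rewrite (big_fsetD1 a aS) [in RHS](big_fsetD1 a aS) /= eqxx /=.
set P := \prod_(b <- _) _; set Q := \prod_(b <- _) _.
have -> : Q = P.
  by apply: eq_big_seq => b; rewrite !inE => /andP[/negbTE ->].
by case: ifP => _; ring.
Qed.

(** Moving an initial segment to the end costs the sign of each letter which has
    one occurrence in either part; a letter with both occurrences in the moved
    part changes sign twice. *)
Lemma bracket_pairing_rot (T : pointedType) (sgn : T -> int) v (w1 w2 : seq T) :
  (forall a, count_mem a (w1 ++ w2) <= 2)%N ->
  bracket_pairing sgn v (w1 ++ w2) =
  bracket_pairing (fun b => if (b \in w1) && (b \in w2) then - sgn b else sgn b)
    v (w2 ++ w1).
Proof.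
elim: w1 w2 sgn => [|a w1 IH] w2 sgn c2.
  by rewrite cats0; apply: eq_bracket_pairing.
rewrite cat_cons bracket_pairing_rotate1 rcons_cat IH; last first.
  move=> b; have := c2 b; rewrite -cats1 !count_cat /= addn0 => /(leq_trans _); apply.
  by rewrite addnA addnC addnA.
rewrite cat_rcons; apply: eq_bracket_pairing => b _.
rewrite !inE mem_rcons !mem_cat inE; case: (eqVneq b a) => [->|] //=.
have := c2 a; rewrite /= eqxx count_cat -!has_pred1 !has_count.
by case: (count_mem a w1) => [|k]; case: (count_mem a w2) => [|l] //=; rewrite ?opprK // addnS.
Qed.
(** * The times of passage through the singularities *)

Section Times.
Variable R : realType.
Implicit Types (F : front R) (b s t : R) (L : seq R).

Lemma periodic_int (U : Type) (f : R -> U) (k : int) t :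
  (forall t, f (t + 1) = f t) -> f (t + k%:~R) = f t.
Proof.
move=> f1; have fn (n : nat) u : f (u + n%:R) = f u.
  by elim: n u => [|n IH] u; rewrite ?addr0 // -natr1 addrA f1.
case: k => n; first by rewrite -pmulrn fn.
by rewrite NegzE mulrNz -pmulrn -(fn n.+1 (t - _)) subrK.
Qed.

Lemma curve_shift F (k : int) t : curve F (t + k%:~R) = curve F t.
Proof. by apply: periodic_int; apply: curve_periodic. Qed.

Lemma derive1_shift F (k : int) t :
  derive1 (curve F) (t + k%:~R) = derive1 (curve F) t.
Proof.
rewrite /derive1; apply: (congr1 (fun f => lim (f @ 0^'))); apply/funext => h.
by rewrite addrA !curve_shift.
Qed.

Lemma same_param_shift (k : int) s t : same_param (s + k%:~R) t <-> same_param s t.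
Proof.
split=> -[m E]; first by exists (m - k); rewrite rmorphB /= addrA -E addrK.
by exists (m + k); rewrite rmorphD /= addrA -E.
Qed.

Lemma same_param_sym s t : same_param s t -> same_param t s.
Proof. by case=> k ->; exists (- k); rewrite rmorphN addrK. Qed.

Lemma same_param_eq s t : same_param s t -> `|s - t| < 1 -> s = t.
Proof.
case=> k ->; rewrite addrC addKr -intr_norm -[1]/(1%:~R) ltr_int.
by case: k => [[|n]|n] //; rewrite addr0.
Qed.

Lemma singular_shift F (k : int) t : singular F (t + k%:~R) <-> singular F t.
Proof.
rewrite /singular /cusp derive1_shift /double curve_shift.
suff E s : same_param s (t + k%:~R) <-> same_param s t.
  by split=> -[?|[s [st Es]]]; [left|right; exists s; rewrite -?E|left|right; exists s; rewrite ?E].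
by split=> /same_param_sym H; apply/same_param_sym; move: H; rewrite same_param_shift.
Qed.

Definition sing_set F b : set R := [set t | b < t < b + 1 /\ singular F t].

Lemma sing_timesP F b (L : seq R) :
  sorted <%R L -> (forall t, t \in L <-> sing_set F b t) -> sing_times F b = L.
Proof.
move=> sL HL; have E : sing_set F b = [set` L] by apply/seteqP; split=> t /HL.
have fin : finite_set (sing_set F b) by rewrite E; exact: finite_seq.
apply: lt_sorted_eq => //; first by rewrite sort_lt_sorted fset_uniq.
move=> t; rewrite mem_sort in_fset_set // -/(sing_set F b) E.
by apply/idP/idP; rewrite inE.
Qed.

Lemma sing_times_infinite F b : ~ finite_set (sing_set F b) -> sing_times F b = [::].
Proof. by rewrite /sing_times -/(sing_set F b) /fset_set; case: pselect. Qed.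

Lemma mem_sing_times F b t :
  finite_set (sing_set F b) -> t \in sing_times F b <-> sing_set F b t.
Proof.
move=> fin; rewrite mem_sort in_fset_set // -/(sing_set F b).
by split; rewrite inE.
Qed.

Lemma sing_times_sub F b t : t \in sing_times F b -> sing_set F b t.
Proof.
case: (pselect (finite_set (sing_set F b))) => [/mem_sing_times ->//|].
by move/sing_times_infinite ->.
Qed.

Lemma sing_times_sorted F b : sorted <%R (sing_times F b).
Proof. by rewrite sort_lt_sorted fset_uniq. Qed.

(** Serves both for a translation by whole periods and for a reparametrization.  If
    there are infinitely many singularities, both lists are empty. *)
Lemma sing_times_map F F' (h : R -> R) b :
  {mono h : s t / s < t} -> (forall t, h (t + 1) = h t + 1) ->
  (forall t, exists s, h s = t) ->
  (forall t, singular F (h t) <-> singular F' t) ->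
  sing_times F (h b) = map h (sing_times F' b).
Proof.
move=> hmono h1 hsurj hs.
have E : sing_set F (h b) = h @` sing_set F' b.
  apply/seteqP; split=> t => [[]|[s [bs /hs ss] <-]].
    have [s <-] := hsurj t; rewrite -h1 !hmono => bs /hs ss.
    by exists s.
  by split=> //; rewrite -h1 !hmono.
have hinj : injective h.
  by move=> s t st; case: (ltgtP s t) => //; rewrite -hmono st ltxx.
case: (pselect (finite_set (sing_set F' b))) => fin; last first.
  rewrite [in RHS]sing_times_infinite // sing_times_infinite // E => fin'.
  apply: fin; have : finite_set (h @^-1` (h @` sing_set F' b)).
    by apply: finite_preimage fin' => ? ? _ _; apply: hinj.
  by apply: sub_finite_set => s ss; exists s.
apply: sing_timesP => [|t]; last rewrite E.
  by rewrite (homo_sorted _ _ (sing_times_sorted F' b)) // => s t; rewrite hmono.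
split=> [/mapP[s /(mem_sing_times s fin) ss ->]|[s /(mem_sing_times s fin) ss <-]].
  by exists s.
exact: map_f.
Qed.

(** The passages between [b] and [b'] come first when starting at [b], and last, one
    period later, when starting at [b']. *)
Lemma sing_times_cut F b b' :
  b < b' < b + 1 -> base_point F b -> base_point F b' ->
  exists T1 T2, sing_times F b = T1 ++ T2 /\
    sing_times F b' = T2 ++ [seq t + 1 | t <- T1].
Proof.
move=> /andP[bb' b'b] nb nb'.
have sh1 t : singular F (t + 1) <-> singular F t by apply: (singular_shift F 1).
have E t : sing_set F b' t <-> (sing_set F b t /\ b' < t) \/ (sing_set F b (t - 1) /\ t - 1 < b').
  split=> [[/andP[b't tb'] st]|].
    case: (ltgtP t (b + 1)) => tb; [left|right|].
    - by split=> //; split=> //; rewrite tb (lt_trans bb').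
    - split; last by rewrite ltrBlDr.
      split; last by rewrite -sh1 subrK.
      by rewrite ltrBrDr tb ltrBlDr (lt_trans tb') // ltrD2r.
    - by case: nb; rewrite -sh1 -tb.
  case=> [[[/andP[bt tb] st] b't]|[[/andP[bt tb] /(proj2 (sh1 _)) st] tb']].
    by split=> //; rewrite b't (lt_trans tb) // ltrD2r.
  by rewrite subrK in st; split=> //; move: bt tb tb' b'b; lra.
case: (pselect (finite_set (sing_set F b))) => fin; last first.
  exists [::], [::]; rewrite !sing_times_infinite // => fin'; apply: fin.
  have : finite_set ((fun t => if t < b + 1 then t else t - 1) @` sing_set F b').
    exact: finite_image.
  apply: sub_finite_set => t [/andP[bt tb] st].
  case: (ltgtP t b') => tb'; last by case: nb'; rewrite -tb'.
    exists (t + 1); last by rewrite ltrD2r ltNge (ltW bt) addrK.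
    by apply/E; right; rewrite addrK; split=> //; split=> //; rewrite bt.
  by exists t; rewrite ?tb //; apply/E; left; split=> //; split=> //; rewrite bt.
pose T := sing_times F b; have memT t := mem_sing_times t fin.
have sT : sorted <%R T := sing_times_sorted F b.
exists [seq t <- T | t < b'], [seq t <- T | b' < t]; split.
  apply: sing_timesP => [|t].
    rewrite (@sorted_pairwise _ _ lt_trans) pairwise_cat -!(@sorted_pairwise _ _ lt_trans).
    rewrite !lt_sorted_filter // !andbT; apply/allrelP => s t.
    by rewrite !mem_filter => /andP[sb _] /andP[bt _]; apply: lt_trans bt.
  rewrite -memT mem_cat !mem_filter -andb_orl; split=> [/andP[]//|tT].
  by rewrite tT andbT -neq_lt; apply/eqP => tb; case/memT: tT => _; rewrite tb.
apply: sing_timesP => [|t].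
  rewrite (@sorted_pairwise _ _ lt_trans) pairwise_cat -!(@sorted_pairwise _ _ lt_trans).
  rewrite lt_sorted_filter // (homo_sorted _ _ (lt_sorted_filter _ sT)) ?andbT.
    apply/allrelP => s t; rewrite mem_filter => /andP[_ /memT[/andP[_ sb] _]] /mapP[u].
    rewrite mem_filter => /andP[_ /memT[/andP[bu _] _]] ->.
    by rewrite (lt_trans sb) // ltrD2r.
  by move=> s u /=; rewrite ltrD2r.
rewrite E mem_cat mem_filter; split=> [/orP[/andP[-> /memT ?]|/mapP[u]]|]; first by left.
  by rewrite mem_filter => /andP[ub /memT su] ->; right; rewrite addrK.
case=> [[/memT -> ->] //|[/memT tT tb']].
by apply/orP; right; apply/mapP; exists (t - 1); rewrite ?subrK // mem_filter tb'.
Qed.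

(** * Signs of the letters *)

Definition times_at F b (A : plane R) := [seq t <- sing_times F b | curve F t == A].

(** [letter_sign] in terms of the passages alone, which can be translated by a
    period or reparametrized. *)
Definition passage_sign F L : int :=
  match L with
  | [:: s, t & _] => if det2 (derive1 (curve F) s) (derive1 (curve F) t) < 0 then 1 else -1
  | [:: s] => if `[< turns_left F s >] then -1 else 1
  | [::] => 0
  end.

Lemma letter_signE F b A : letter_sign F b A = passage_sign F (times_at F b A).
Proof. by []. Qed.

Lemma front_pairingE F b v :
  front_pairing F b v = bracket_pairing (letter_sign F b) v (front_word F b).
Proof. by []. Qed.

Lemma passage_sign_shift F (k : int) L :
  passage_sign F [seq t + k%:~R | t <- L] = passage_sign F L.
Proof.
case: L => [|s [|t L]]; rewrite /= ?derive1_shift; [by []| |by []].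
suff -> : turns_left F (s + k%:~R) = turns_left F s by [].
have E u : curve F (s + k%:~R + u) = curve F (s + u) by rewrite addrAC curve_shift.
rewrite /turns_left curve_shift.
apply: (congr1 (fun P : set R => \forall h \near 0^'+, P h)); apply/funext => h.
by rewrite !E.
Qed.

Lemma det2_anti (u v : plane R) : det2 u v = - det2 v u.
Proof. rewrite /det2; ring. Qed.

Lemma same_time F b s t : s \in sing_times F b -> t \in sing_times F b ->
  same_param s t -> s = t.
Proof.
move=> /sing_times_sub[/andP[bs sb] _] /sing_times_sub[/andP[bt tb] _] st.
apply: same_param_eq => //; rewrite ltr_norml; apply/andP; lra.
Qed.

Lemma uniq_times_at F b A : uniq (times_at F b A).
Proof. exact/filter_uniq/(lt_sorted_uniq (sing_times_sorted F b)). Qed.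

(** There are no triple points. *)
Lemma size_times_at F b A : (size (times_at F b A) <= 2)%N.
Proof.
have := uniq_times_at F b A.
have H t : t \in times_at F b A -> t \in sing_times F b /\ curve F t = A.
  by rewrite mem_filter => /andP[/eqP].
case: times_at H => [|s [|t [|u L]]] //= H; rewrite !inE !negb_or.
have [sT sA] := H s (mem_head _ _).
have [tT tA] : t \in sing_times F b /\ curve F t = A by apply: H; rewrite !inE eqxx orbT.
have [uT uA] : u \in sing_times F b /\ curve F u = A by apply: H; rewrite !inE eqxx !orbT.
case: (@curve_no_triple _ F s t u); rewrite ?sA ?tA ?uA // => /same_time E.
- by rewrite (E F b) // eqxx.
- by rewrite (E F b tT) // eqxx !andbF.
- by rewrite (E F b) // eqxx andbF.
Qed.

(** When the base point passes over one of the two passages of a double point,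
    their order and hence its sign changes. *)
Lemma letter_sign_cut F b b' T1 T2 A :
  sing_times F b = T1 ++ T2 -> sing_times F b' = T2 ++ [seq t + 1 | t <- T1] ->
  letter_sign F b' A =
  if (A \in map (curve F) T1) && (A \in map (curve F) T2)
  then - letter_sign F b A else letter_sign F b A.
Proof.
move=> E E'; rewrite !letter_signE.
have nonempty L : (A \in map (curve F) L) = ([seq t <- L | curve F t == A] != [::]).
  rewrite -has_filter; apply/mapP/hasP => -[t tL] => [->|/eqP <-]; by exists t.
have := size_times_at F b A; have := uniq_times_at F b A.
have : {subset times_at F b A <= sing_times F b} by exact: mem_subseq (filter_subseq _ _).
have : forall t, t \in times_at F b A -> curve F t = A.
  by move=> t; rewrite mem_filter => /andP[/eqP].
rewrite !nonempty /times_at E E' !filter_cat filter_map.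
have -> : [seq t <- T1 | preim (fun t => t + 1) (fun t => curve F t == A) t] =
          [seq t <- T1 | curve F t == A].
  by apply: eq_filter => t /=; rewrite curve_periodic.
rewrite -E.
set L1 := seq.filter _ T1; set L2 := seq.filter _ T2.
have sh : [seq t + 1 | t <- L1] = [seq t + 1%:~R | t <- L1] by [].
rewrite sh; case: L1 {sh} => [|s1 [|s1' L1]]; first by rewrite cats0.
  case: L2 => [|s2 [|s2' L2]] LA sub un sz; last by [].
    by rewrite cats0; exact: (passage_sign_shift F 1 [:: s1]).
  have [T1s T2s] : s1 \in sing_times F b /\ s2 \in sing_times F b.
    by split; apply: sub; rewrite !inE eqxx ?orbT.
  rewrite /= (derive1_shift F 1) (det2_anti (derive1 _ s2)) oppr_lt0.
  have : det2 (derive1 (curve F) s1) (derive1 (curve F) s2) != 0.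
    apply: curve_transversal; last by rewrite !LA ?inE ?eqxx ?orbT.
    move=> /(same_time T1s T2s) s12; by rewrite s12 /= inE eqxx in un.
  by case: ltgtP => // _ _; rewrite ?opprK.
case: L2 => [|s2 L2] _ _ _ sz; last by rewrite size_cat /= addnS in sz.
by rewrite cats0; exact: (passage_sign_shift F 1 [:: s1, s1' & L1]).
Qed.

Lemma front_pairing_shift F b (k : int) v :
  front_pairing F (b + k%:~R) v = front_pairing F b v.
Proof.
have E : sing_times F (b + k%:~R) = [seq t + k%:~R | t <- sing_times F b].
  apply: (@sing_times_map F F (fun t => t + k%:~R)) => [s t|t|t|t].
  - by rewrite ltrD2r.
  - by rewrite addrAC.
  - by exists (t - k%:~R); rewrite subrK.
  - exact: singular_shift.
rewrite !front_pairingE /front_word E -map_comp.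
rewrite (@eq_map _ _ (curve F \o _) (curve F)); last by move=> t /=; rewrite curve_shift.
apply: eq_bracket_pairing => A _; rewrite !letter_signE /times_at E filter_map passage_sign_shift.
by congr passage_sign; apply: eq_filter => t /=; rewrite curve_shift.
Qed.

(** After translation by whole periods [b'] lies in the period from [b] and the word
    at [b'] is a rotation of the word at [b]; the signs which the rotation costs are
    those which the double points on both sides of [b'] undergo. *)
Lemma front_pairing_base F b b' v :
  base_point F b -> base_point F b' -> front_pairing F b v = front_pairing F b' v.
Proof.
move=> nb nb'; pose k := Num.floor (b' - b).
have /andP[k0 k1] := floor_itv (b' - b); rewrite -/k in k0 k1.
rewrite -(front_pairing_shift F b' (- k)).
have nc : base_point F (b' + (- k)%:~R) by rewrite /base_point singular_shift.
move: nc; have : b <= b' + (- k)%:~R < b + 1.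
  by rewrite intrD in k1; rewrite rmorphN /=; apply/andP; split; move: k0 k1; lra.
move: (b' + _) => c; rewrite le_eqVlt => /andP[/orP[/eqP <- //|bc] cb] nc.
have [T1 [T2 [E E']]] : exists T1 T2, sing_times F b = T1 ++ T2 /\
    sing_times F c = T2 ++ [seq t + 1 | t <- T1] by apply: sing_times_cut; rewrite ?bc.
rewrite !front_pairingE /front_word E E' !map_cat -map_comp.
rewrite (@eq_map _ _ (curve F \o _) (curve F)); last by move=> t /=; rewrite curve_periodic.
rewrite bracket_pairing_rot.
  by apply: eq_bracket_pairing => A _; rewrite (letter_sign_cut A E E').
move=> A; rewrite -map_cat -E count_map -size_filter.
exact: size_times_at.
Qed.

End Times.
(** * Differential calculus in the plane *)

Section Calculus.
Variable R : realType.
Implicit Types (s t : R) (z : plane R).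

Lemma is_derive_cvg (V W : normedModType R) (f : V -> W) (x v : V) (d : W) :
  (h^-1 *: (f (h *: v + x) - f x)) @[h --> 0^'] --> d <-> is_derive x v f d.
Proof.
split=> [C|[dx <-]]; last exact: dx.
by constructor; [exact: (cvgP _ C)|exact: (cvg_lim _ C)].
Qed.

Lemma is_derive_fst (V : normedModType R) (f : V -> plane R) (x v : V) d :
  is_derive x v f d -> is_derive x v (fun y => (f y).1) d.1.
Proof.
move=> /is_derive_cvg C; apply/is_derive_cvg.
have L : y.1 @[y --> d] --> d.1 by exact: cvg_fst.
exact: (cvg_comp _ _ C L).
Qed.

Lemma is_derive_snd (V : normedModType R) (f : V -> plane R) (x v : V) d :
  is_derive x v f d -> is_derive x v (fun y => (f y).2) d.2.
Proof.
move=> /is_derive_cvg C; apply/is_derive_cvg.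
have L : y.2 @[y --> d] --> d.2 by exact: cvg_snd.
exact: (cvg_comp _ _ C L).
Qed.

Lemma smooth_is_derive (W : normedModType R) (f : R -> W) k t :
  smooth f -> is_derive t (1 : R) (derive1n k f) (derive1n k.+1 f t).
Proof.
move=> fs; suff D : differentiable (derive1n k f) t.
  by rewrite derive1nS derive1E; apply: derivableP; exact: diff_derivable.
have {fs} := fs k; elim: k f t => [|k IH] f t [fd fk]; first exact: fd.
rewrite derive1Sn; apply: IH; have := fk 1.
by congr (ndiff k _); apply/funext => x; rewrite derive1E.
Qed.

(** * The side to which a semicubical cusp turns *)

(** The mean value theorem raises the order of vanishing of a derivative by one. *)
Lemma flat_bound (q dq : R -> R) (e r : R) n :
  q 0 = 0 -> (forall h, `|h| < r -> is_derive h (1 : R) q (dq h)) ->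
  (forall h, `|h| < r -> `|dq h| <= e * `|h| ^+ n) ->
  forall h, `|h| < r -> `|q h| <= e * `|h| ^+ n.+1.
Proof.
move=> q0 qd dqe h hr.
have cont a b : `|a| < r -> `|b| < r -> {within `[a, b], continuous q}.
  move=> ar br; apply: continuous_in_subspaceT => x; rewrite inE /= in_itv /= => xab.
  apply: differentiable_continuous; apply/derivable1_diffP.
  have : `|x| < r by move: ar br xab; rewrite !ltr_norml; lra.
  by case/qd.
have step c : `|c| <= `|h| -> `|dq c * h| <= e * `|h| ^+ n.+1.
  move=> ch; rewrite normrM exprSr mulrA ler_wpM2r //.
  apply: le_trans (dqe c (le_lt_trans ch hr)) _.
  case: (ltP e 0) => e0; last by rewrite ler_wpM2l // lerXn2r // nnegrE.
  have := le_trans (normr_ge0 _) (dqe h hr); have := le_trans (normr_ge0 _) (dqe c (le_lt_trans ch hr)).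
  rewrite !nmulr_rge0 // => c0 h0.
  have -> : `|h| ^+ n = 0 by apply/eqP; rewrite eq_le h0 exprn_ge0.
  by rewrite mulr0 nmulr_rle0 // exprn_ge0.
have r0 : `|0 : R| < r by rewrite normr0 (le_lt_trans _ hr).
case: (leP 0 h) => h0.
  have [|c] := @MVT_segment _ q dq 0 h h0 _ (cont _ _ r0 hr).
    by move=> x; rewrite in_itv /= => /andP[x0 xh]; apply: qd; move: hr; rewrite !ltr_norml; lra.
  rewrite in_itv /= => /andP[c0 ch]; rewrite q0 !subr0 => ->.
  by apply: step; rewrite !ger0_norm.
have [|c] := @MVT_segment _ q dq h 0 (ltW h0) _ (cont _ _ hr r0).
  by move=> x; rewrite in_itv /= => /andP[x0 xh]; apply: qd; move: hr; rewrite !ltr_norml; lra.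
rewrite in_itv /= => /andP[c0 ch]; rewrite q0 !sub0r mulrN => /oppr_inj ->.
by apply: step; rewrite !ler0_norm ?lerN2 // ltW.
Qed.

(** Peano form of the Taylor formula: the remainder of order 3 is [o(h ^ 3)] since
    its second derivative is [o(h)], by differentiability of [ddp] at [t]. *)
Lemma taylor3_critical (p dp ddp : R -> R) t b :
  (forall s, is_derive s (1 : R) p (dp s)) -> (forall s, is_derive s (1 : R) dp (ddp s)) ->
  is_derive t (1 : R) ddp b -> dp t = 0 ->
  (p (t + h) - p t - ddp t / 2 * h ^+ 2) / h ^+ 3 @[h --> 0^'] --> b / 6.
Proof.
move=> pd dpd /is_derive_cvg ddpd dp0; apply/cvgrPdist_le => /= e e0.
have /cvgrPdist_le /(_ e e0) := ddpd.
case/nbhs_ballP => r /= r0 Hr.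
have sh (f df : R -> R) s : is_derive (t + s) (1 : R) f (df (t + s)) ->
    is_derive s (1 : R) (fun h => f (t + h)) (df (t + s)).
  move=> fd; rewrite -[df _]mulr1; apply: (is_derive1_comp fd).
  have : is_derive s (1 : R) (cst t + id) (0 + 1) by exact: is_deriveD.
  by rewrite add0r.
pose q2 h := ddp (t + h) - ddp t - h * b.
pose q1 h := dp (t + h) - h * ddp t - h ^+ 2 * (b / 2).
pose q0 h := p (t + h) - p t - h ^+ 2 * (ddp t / 2) - h ^+ 3 * (b / 6).
have B2 h : `|h| < r -> `|q2 h| <= e * `|h| ^+ 1.
  move=> hr; case: (eqVneq h 0) => [->|h0].
    by rewrite /q2 addr0 subrr mul0r subr0 normr0 expr1 mulr0.
  have := Hr h; rewrite /ball /= sub0r normrN => /(_ hr h0).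
  rewrite expr1 -ler_pdivrMr ?normr_gt0 // -normfV -normrM distrC.
  congr (_ <= _); congr `| _ |; rewrite /q2 /GRing.scale /= mulr1 (addrC h t).
  by field.
have X n c h : is_derive h (1 : R) (fun u => u ^+ n.+1 * c) (h ^+ n *+ n.+1 * c).
  have := is_deriveM (is_deriveX n.+1 (is_derive_id h (1 : R))) (is_derive_cst c h 1).
  rewrite exprfctE => H; apply: (is_derive_eq H); rewrite /GRing.scale /=; ring.
have D1 h : is_derive h (1 : R) q1 (q2 h).
  apply: (is_derive_eq (is_deriveB (is_deriveB (sh _ _ _ (dpd _)) (X 0%N _ _)) (X 1%N _ _))).
  by rewrite /q2; field.
have D0 h : is_derive h (1 : R) q0 (q1 h).
  apply: (is_derive_eq (is_deriveB (is_deriveB (is_deriveB (sh _ _ _ (pd _))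
    (is_derive_cst (p t) h 1)) (X 1%N _ _)) (X 2%N _ _))).
  by rewrite /q1; field.
have q10 : q1 0 = 0 by rewrite /q1 addr0 dp0 mul0r expr0n mul0r !subr0.
have q00 : q0 0 = 0 by rewrite /q0 addr0 subrr !expr0n !mul0r !subr0.
have B1 := flat_bound q10 (fun h _ => D1 h) B2.
have B0 := flat_bound q00 (fun h _ => D0 h) B1.
near=> h; have h0 : h != 0 by near: h; exact: nbhs_dnbhs_neq.
have hr : `|h| < r.
  by near: h; exact: dnbhs0_lt.
have := B0 h hr; rewrite -ler_pdivrMr ?exprn_gt0 ?normr_gt0 //.
rewrite -normrX -normfV -normrM distrC; congr (_ <= _); congr `| _ |.
by rewrite /q0; field.
Unshelve. all: by end_near. Qed.

End Calculus.
Section Cusps.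
Variable R : realType.
Implicit Types (F : front R) (s t : R) (z u v : plane R).

Lemma near_right_dnbhs (P : set R) :
  (\forall h \near 0^', P h) -> \forall h \near 0^'+, P h /\ P (- h).
Proof.
case/nbhs_ballP => r /= r0 Hr; near=> h.
have h0 : 0 < h by near: h; exact: nbhs_right_gt.
have hr : h < r by near: h; exact: nbhs_right_lt.
have hn : h != 0 by rewrite gt_eqF.
by split; apply: Hr; rewrite /ball /= ?oppr_eq0 // sub0r ?opprK ?normrN gtr0_norm.
Unshelve. all: by end_near. Qed.

(** With [a] and [b] the second and third derivatives, the outgoing and incoming
    branches are, relative to the cusp, [h ^ 2 / 2 * a + h ^ 3 / 6 * b + o(h ^ 3)]
    and [h ^ 2 / 2 * a - h ^ 3 / 6 * b + o(h ^ 3)], so the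
    determinant in [turns_left] is [- h ^ 5 / 6 * det2 a b + o(h ^ 5)]. *)
Lemma turns_left_det F t : cusp (curve F) t ->
  turns_left F t <-> det2 (derive1n 2 (curve F) t) (derive1n 3 (curve F) t) < 0.
Proof.
move=> ct; have D0 := curve_semicubical ct.
set g := curve F in ct D0 *; set a := derive1n 2 g t in D0 *; set b := derive1n 3 g t in D0 *.
have gd k s := @smooth_is_derive R _ _ k s (curve_smooth F).
pose r1 h := ((g (t + h)).1 - (g t).1 - a.1 / 2 * h ^+ 2) / h ^+ 3.
pose r2 h := ((g (t + h)).2 - (g t).2 - a.2 / 2 * h ^+ 2) / h ^+ 3.
have L1 : r1 h @[h --> 0^'] --> b.1 / 6.
  apply: (@taylor3_critical R _ _ _ _ _ (fun s => is_derive_fst (gd 0%N s))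
    (fun s => is_derive_fst (gd 1%N s)) (is_derive_fst (gd 2%N t))).
  by rewrite derive1n1 ct.
have L2 : r2 h @[h --> 0^'] --> b.2 / 6.
  apply: (@taylor3_critical R _ _ _ _ _ (fun s => is_derive_snd (gd 0%N s))
    (fun s => is_derive_snd (gd 1%N s)) (is_derive_snd (gd 2%N t))).
  by rewrite derive1n1 ct.
have right (r : R -> R) (l : R) : r h @[h --> 0^'] --> l ->
    r h @[h --> 0^'+] --> l /\ r (- h) @[h --> 0^'+] --> l.
  by move=> L; split=> P /L /near_right_dnbhs; apply: filterS => h [].
have [L1p L1n] := right _ _ L1; have [L2p L2n] := right _ _ L2.
clearbody a b.
(* The determinant divided by [h ^ 5], in terms of the remainders. *)
pose E h := - (a.1 / 2) * (r2 (- h) + r2 h) + a.2 / 2 * (r1 h + r1 (- h))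
  + h * (r1 (- h) * r2 h - r1 h * r2 (- h)).
have LE : E h @[h --> 0^'+] --> - (det2 a b / 6).
  have -> : - (det2 a b / 6) = - (a.1 / 2) * (b.2 / 6 + b.2 / 6)
      + a.2 / 2 * (b.1 / 6 + b.1 / 6) + 0 * (b.1 / 6 * (b.2 / 6) - b.1 / 6 * (b.2 / 6)).
    by rewrite /det2; field.
  apply: cvgD; first apply: cvgD; [apply: cvgMl_tmp|apply: cvgMl_tmp|apply: cvgM].
  - exact: cvgD.
  - exact: cvgD.
  - by apply: cvg_at_right_filter; exact: cvg_id.
  - by apply: cvgB; apply: cvgM.
have detE h : 0 < h -> det2 (g t - g (t - h)) (g (t + h) - g (t - h)) = h ^+ 5 * E h.
  move=> h0; have hn : h != 0 by rewrite gt_eqF.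
  by rewrite /det2 /E /r1 /r2 /=; field.
have tl : turns_left F t <-> \forall h \near 0^'+, 0 < E h.
  rewrite /turns_left -/g; split=> H; near=> h.
    have h0 : 0 < h by near: h; exact: nbhs_right_gt.
    have : 0 < det2 (g t - g (t - h)) (g (t + h) - g (t - h)) by near: h.
    by rewrite detE // pmulr_rgt0 // exprn_gt0.
  have h0 : 0 < h by near: h; exact: nbhs_right_gt.
  have : 0 < E h by near: h.
  by rewrite detE // pmulr_rgt0 // exprn_gt0.
rewrite tl; split=> [pos|neg]; last first.
  by apply: (cvgr_gt _ LE); move: neg; lra.
case: (ltgtP (det2 a b) 0) => // [Dp|D00]; last by rewrite D00 eqxx in D0.
have neg : \forall h \near 0^'+, E h < 0.
  by apply: (cvgr_lt _ LE); move: Dp; lra.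
have [h [p n]] : exists h, 0 < E h /\ E h < 0.
  exact: (@filter_ex _ (0^'+) _ _ (filterI pos neg)).
by rewrite ltNge ltW in p.
Unshelve. all: by end_near. Qed.

End Cusps.
(** * Jets of the image of a curve *)

Section Jets.
Variable R : realType.
Implicit Types (s t : R) (z u : plane R).

Lemma derive_plane (W : normedModType R) (f : plane R -> W) z u :
  differentiable f z ->
  'D_u f z = u.1 *: 'D_(1, 0) f z + u.2 *: 'D_(0, 1) f z.
Proof.
move=> fd; rewrite !deriveE // -!linearZ -linearD; congr ('d f z _).
by case: u => a b; congr pair; rewrite /= /GRing.scale /=; ring.
Qed.

Lemma is_derive_chain (W : normedModType R) (f : plane R -> W)
    (g : R -> plane R) t d :
  differentiable f (g t) -> is_derive t (1 : R) g d ->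
  is_derive t (1 : R) (f \o g) ('D_d f (g t)).
Proof.
move=> fd [gd <-]; have gd' : differentiable g t by apply/derivable1_diffP.
have fgd : differentiable (f \o g) t by exact: differentiable_comp.
have -> : 'D_('D_1 g t) f (g t) = 'D_1 (f \o g) t.
  rewrite [LHS]deriveE // [RHS]deriveE // [X in 'd f _ X]deriveE //.
  by rewrite (diff_comp gd' fd).
by apply: derivableP; exact: diff_derivable.
Qed.

Lemma smooth_differentiable (V W : normedModType R) (f : V -> W) x :
  smooth f -> differentiable f x.
Proof. by move/(_ 0%N) => []. Qed.

Lemma smooth_derive (V W : normedModType R) (f : V -> W) v :
  smooth f -> smooth (fun x => 'D_v f x).
Proof. by move=> fs k; have [_] := fs k.+1; apply. Qed.

Lemma differentiable_fst (V : normedModType R) (f : V -> plane R) x :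
  differentiable f x -> differentiable (fun y => (f y).1) x.
Proof.
move=> fd; apply: (@differentiable_comp _ _ _ _ f fst) => //.
by apply: linear_differentiable => z; exact: cvg_fst.
Qed.

Lemma differentiable_snd (V : normedModType R) (f : V -> plane R) x :
  differentiable f x -> differentiable (fun y => (f y).2) x.
Proof.
move=> fd; apply: (@differentiable_comp _ _ _ _ f snd) => //.
by apply: linear_differentiable => z; exact: cvg_snd.
Qed.

Lemma derive_fst (V : normedModType R) (f : V -> plane R) x v :
  differentiable f x -> 'D_v (fun y => (f y).1) x = ('D_v f x).1.
Proof.
by move=> fd; apply: derive_val; apply: is_derive_fst; apply: derivableP; exact: diff_derivable.
Qed.

Lemma derive_snd (V : normedModType R) (f : V -> plane R) x v :
  differentiable f x -> 'D_v (fun y => (f y).2) x = ('D_v f x).2.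
Proof.
by move=> fd; apply: derive_val; apply: is_derive_snd; apply: derivableP; exact: diff_derivable.
Qed.

Lemma smooth_fst (V : normedModType R) (f : V -> plane R) :
  smooth f -> smooth (fun y => (f y).1).
Proof.
move=> fs k; elim: k f fs => [|k IH] f fs; split=> [x|];
  try exact/differentiable_fst/smooth_differentiable.
  by [].
move=> v; have := IH _ (smooth_derive v fs); congr (ndiff k _); apply/funext => x.
by rewrite derive_fst //; exact: smooth_differentiable.
Qed.

Lemma smooth_snd (V : normedModType R) (f : V -> plane R) :
  smooth f -> smooth (fun y => (f y).2).
Proof.
move=> fs k; elim: k f fs => [|k IH] f fs; split=> [x|];
  try exact/differentiable_snd/smooth_differentiable.
  by [].
move=> v; have := IH _ (smooth_derive v fs); congr (ndiff k _); apply/funext => x.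
by rewrite derive_snd //; exact: smooth_differentiable.
Qed.

(** The first two derivatives are required on the whole line so that jets can be
    composed by the product rule. *)
Definition jet3 (f : R -> R) t (j1 j2 j3 : R) := exists df ddf : R -> R,
  [/\ forall s, is_derive s (1 : R) f (df s), forall s, is_derive s (1 : R) df (ddf s),
      is_derive t (1 : R) ddf j3, df t = j1 & ddf t = j2].

(** At a critical point of [g] the terms with derivatives of [f] of order 2 and 3
    all contain a factor [g' t = 0]. *)
Lemma jet3_comp_critical (f : plane R -> R) (g dg ddg : R -> plane R) t d3 :
  smooth f -> (forall s, is_derive s (1 : R) g (dg s)) ->
  (forall s, is_derive s (1 : R) dg (ddg s)) -> is_derive t (1 : R) ddg d3 ->
  dg t = 0 ->
  jet3 (f \o g) t 0 ('D_(ddg t) f (g t)) ('D_d3 f (g t)).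
Proof.
move=> fs gd dgd ddgd dg0.
have fd z := smooth_differentiable z fs.
have fsd v := smooth_derive v fs.
have fdd v z := smooth_differentiable z (fsd v).
have fddd v w z := smooth_differentiable z (smooth_derive w (fsd v)).
have dg10 : (dg t).1 = 0 by rewrite dg0.
have dg20 : (dg t).2 = 0 by rewrite dg0.
have partial v : exists p dp : R -> R, [/\ forall s, 'D_v f (g s) = p s,
    forall s, is_derive s (1 : R) p (dp s), dp t = 0 &
    exists c, is_derive t (1 : R) dp c].
  exists (fun s => 'D_v f (g s)).
  exists (fun s => (dg s).1 * 'D_(1, 0) ('D_v f) (g s) + (dg s).2 * 'D_(0, 1) ('D_v f) (g s)).
  split=> // [s||].
  - by apply: (is_derive_eq (is_derive_chain (fdd v _) (gd s))); rewrite derive_plane.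
  - rewrite dg10 dg20; apply: etrans (addr0 _); congr (_ + _); exact: mul0r.
  - eexists; apply: is_deriveD; apply: is_deriveM.
    + exact: is_derive_fst.
    + exact: (is_derive_chain (fddd _ _ _) (gd t)).
    + exact: is_derive_snd.
    + exact: (is_derive_chain (fddd _ _ _) (gd t)).
have [p1 [dp1 [p1E p1d dp10 [c1 dp1d]]]] := partial (1, 0).
have [p2 [dp2 [p2E p2d dp20 [c2 dp2d]]]] := partial (0, 1).
pose u1 s := (dg s).1; pose u2 s := (dg s).2.
pose w1 s := (ddg s).1; pose w2 s := (ddg s).2.
have u1d s : is_derive s (1 : R) u1 (w1 s) by exact: is_derive_fst.
have u2d s : is_derive s (1 : R) u2 (w2 s) by exact: is_derive_snd.
have w1d : is_derive t (1 : R) w1 d3.1 by exact: is_derive_fst.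
have w2d : is_derive t (1 : R) w2 d3.2 by exact: is_derive_snd.
have u10 : u1 t = 0 by [].
have u20 : u2 t = 0 by [].
have DE w s : 'D_w f (g s) = w.1 * p1 s + w.2 * p2 s.
  by rewrite derive_plane // p1E p2E.
exists (u1 * p1 + u2 * p2).
exists ((w1 * p1 + u1 * dp1) + (w2 * p2 + u2 * dp2)); split.
- by move=> s; apply: (is_derive_eq (is_derive_chain (fd _) (gd s))); rewrite DE.
- move=> s; apply: (is_derive_eq (is_deriveD (is_deriveM (u1d s) (p1d s))
    (is_deriveM (u2d s) (p2d s)))).
  by rewrite /= !fctE /GRing.scale /=; ring.
- have H := is_deriveD (is_deriveD (is_deriveM w1d (p1d t)) (is_deriveM (u1d t) dp1d))
    (is_deriveD (is_deriveM w2d (p2d t)) (is_deriveM (u2d t) dp2d)).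
  by apply: (is_derive_eq H); rewrite dp10 dp20 u10 u20 DE /GRing.scale /=; ring.
- by rewrite !fctE u10 u20 !mul0r addr0.
- by rewrite !fctE dp10 dp20 !mulr0 !addr0 DE.
Qed.

(** Only terms with a derivative of [f] of order at least 2 survive. *)
Lemma jet3_reparam (f sg d1 d2 : R -> R) t d3 j2 j3 :
  (forall s, is_derive s (1 : R) sg (d1 s)) -> (forall s, is_derive s (1 : R) d1 (d2 s)) ->
  is_derive t (1 : R) d2 d3 -> jet3 f (sg t) 0 j2 j3 ->
  jet3 (f \o sg) t 0 (d1 t ^+ 2 * j2) (3 * d1 t * d2 t * j2 + d1 t ^+ 3 * j3).
Proof.
move=> sgd d1d d2d [df [ddf [fd dfd ddfd df0 ddf0]]].
have D (k dk : R -> R) s : is_derive (sg s) (1 : R) k (dk (sg s)) ->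
    is_derive s (1 : R) (k \o sg) (dk (sg s) * d1 s).
  by move=> kd; apply: is_derive1_comp.
have Ddf s := D df ddf s (dfd _).
have Dddf : is_derive t (1 : R) (ddf \o sg) (j3 * d1 t) by exact: is_derive1_comp.
exists ((df \o sg) * d1); exists ((ddf \o sg) * (d1 * d1) + (df \o sg) * d2); split.
- by move=> s; exact: D.
- move=> s; apply: (is_derive_eq (is_deriveM (Ddf s) (d1d s))).
  by rewrite !fctE /GRing.scale /=; ring.
- have H := is_deriveD (is_deriveM Dddf (is_deriveM (d1d t) (d1d t)))
    (is_deriveM (Ddf t) d2d).
  by apply: (is_derive_eq H); rewrite !fctE /= df0 ddf0 /GRing.scale /=; ring.
- by rewrite !fctE /= df0 mul0r.
- by rewrite !fctE /= df0 ddf0; ring.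
Qed.

Lemma jet3_derive1n (f : R -> R) t j1 j2 j3 : jet3 f t j1 j2 j3 ->
  [/\ derive1 f t = j1, derive1n 2 f t = j2 & derive1n 3 f t = j3].
Proof.
move=> [df [ddf [fd dfd ddfd <- <-]]].
have E (k dk : R -> R) : (forall s, is_derive s (1 : R) k (dk s)) -> derive1 k = dk.
  by move=> kd; apply/funext => s; rewrite derive1E derive_val.
by rewrite !derive1nS !derive1n0 (E _ _ fd) (E _ _ dfd) derive1E derive_val.
Qed.

End Jets.
(** * The differential of an isotopy *)

Section Jacobian.
Variable R : realType.
Implicit Types (s t tau : R) (z u : plane R).

Definition jacobian2 (f : plane R -> plane R) z : R := det2 ('D_(1, 0) f z) ('D_(0, 1) f z).

Lemma det2_derive (f : plane R -> plane R) z u v : differentiable f z ->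
  det2 ('D_u f z) ('D_v f z) = jacobian2 f z * det2 u v.
Proof.
move=> fd; rewrite (derive_plane u fd) (derive_plane v fd) /jacobian2.
move: ('D_(1, 0) f z) ('D_(0, 1) f z) => p q.
by rewrite /det2 /= /GRing.scale /=; ring.
Qed.

Lemma derive_comp_plane (f g : plane R -> plane R) z u : differentiable f z -> differentiable g (f z) ->
  'D_u (g \o f) z = 'D_('D_u f z) g (f z).
Proof.
move=> fd gd; have gfd : differentiable (g \o f) z by exact: differentiable_comp.
have dcomp : 'd (g \o f) z u = 'd g (f z) ('d f z u).
  exact: (congr1 (fun h : plane R -> plane R => h u) (diff_comp fd gd)).
apply: (etrans (deriveE u gfd)); apply: (etrans dcomp).
apply: (etrans _ (esym (deriveE ('D_u f z) gd))).
exact: (congr1 ('d g (f z)) (esym (deriveE u fd))).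
Qed.

Lemma derive_id_plane u z : 'D_u (fun w : plane R => w) z = u.
Proof. exact: derive_id. Qed.

(** The differential of the inverse map inverts the differential. *)
Lemma jacobian2_neq0 (f : plane R -> plane R) z : diffeomorphism f -> jacobian2 f z != 0.
Proof.
move=> [fs [g [gs fK gK]]].
have fd := smooth_differentiable z fs.
have gd := smooth_differentiable (f z) gs.
have E u : 'D_('D_u f z) g (f z) = u.
  rewrite -derive_comp_plane //; have -> : g \o f = (fun w => w) by apply/funext.
  exact: derive_id_plane.
have : det2 ((1, 0) : plane R) (0, 1) = 1 by rewrite /det2 /=; ring.
rewrite -{1}(E (1, 0)) -{1}(E (0, 1)) det2_derive // -/(jacobian2 f z).
by apply: contra_eq_neq => ->; rewrite mulr0 eq_sym oner_neq0.
Qed.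

Lemma isotopy_derive (Phi : R * plane R -> plane R) tau z u :
  'D_u (fun w => Phi (tau, w)) z = 'D_(0, u) Phi (tau, z).
Proof.
rewrite /derive; apply: (congr1 (fun k => lim (k @ 0^'))); apply/funext => h /=.
congr (_ *: (Phi _ - _)); congr pair.
have E : h * 0 + tau = tau by rewrite mulr0 add0r.
exact: esym E.
Qed.

Lemma continuous_fst_comp (T : topologicalType) (f : T -> plane R) :
  continuous f -> continuous (fun x => (f x).1).
Proof. by move=> fc x; apply: (cvg_comp _ _ (fc x)); exact: cvg_fst. Qed.

Lemma continuous_snd_comp (T : topologicalType) (f : T -> plane R) :
  continuous f -> continuous (fun x => (f x).2).
Proof. by move=> fc x; apply: (cvg_comp _ _ (fc x)); exact: cvg_snd. Qed.

Lemma continuous_pair (T U V : topologicalType) (f : T -> U) (g : T -> V) :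
  continuous f -> continuous g -> continuous (fun x => (f x, g x)).
Proof. by move=> fc gc x; exact: (cvg_pair (fc x) (gc x)). Qed.

Lemma smooth_derive_continuous (T : topologicalType) (V W : normedModType R)
    (f : V -> W) v (c : T -> V) :
  smooth f -> continuous c -> continuous (fun x => 'D_v f (c x)).
Proof.
move=> fs cc x; apply: (@continuous_comp _ _ _ c (fun y => 'D_v f y) x (cc x)).
exact: (differentiable_continuous (smooth_differentiable _ (smooth_derive _ fs))).
Qed.

Lemma continuous_det2 (T : topologicalType) (f g : T -> plane R) :
  continuous f -> continuous g -> continuous (fun x => det2 (f x) (g x)).
Proof.
move=> fc gc x; apply: cvgB; apply: cvgM.
- exact: continuous_fst_comp.
- exact: continuous_snd_comp.
- exact: continuous_snd_comp.
- exact: continuous_fst_comp.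
Qed.

Lemma continuous_dot (T : topologicalType) (f g : T -> plane R) :
  continuous f -> continuous g -> continuous (fun x => dot (f x) (g x)).
Proof.
move=> fc gc x; apply: cvgD; apply: cvgM.
- exact: continuous_fst_comp.
- exact: continuous_fst_comp.
- exact: continuous_snd_comp.
- exact: continuous_snd_comp.
Qed.

(** The Jacobian does not vanish along the isotopy and is 1 at its start. *)
Lemma isotopy_jacobian_gt0 (Phi : R * plane R -> plane R) tau z :
  ambient_isotopy Phi -> 0 <= tau <= 1 ->
  0 < jacobian2 (fun w => Phi (tau, w)) z.
Proof.
move=> [Ps P0 Pd] /andP[tau0 tau1].
pose J s := jacobian2 (fun w => Phi (s, w)) z.
have JE : J = fun s => det2 ('D_(0, (1, 0)) Phi (s, z)) ('D_(0, (0, 1)) Phi (s, z)).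
  by apply/funext => s; rewrite /J /jacobian2 !isotopy_derive.
have Jc : continuous J.
  have cz : continuous (fun s : R => (s, z)).
    by apply: continuous_pair => s; [exact: cvg_id|exact: cvg_cst].
  by rewrite JE; apply: continuous_det2; exact: (@smooth_derive_continuous _ _ _ Phi _ (fun s => (s, z)) Ps cz).
have J0 : J 0 = 1.
  rewrite /J /jacobian2; have -> : (fun w => Phi (0, w)) = (fun w => w) by apply/funext.
  by rewrite !derive_id_plane /det2 /=; ring.
rewrite ltNge; apply/negP => Jle.
have [||c] := @IVT R J 0 tau 0 tau0.
- by apply: continuous_in_subspaceT => s _; exact: Jc.
- by rewrite J0 ge_min le_max ler01 Jle orbT.
rewrite in_itv /= => /andP[c0 ct] Jc0.
have c01 : 0 <= c <= 1 by rewrite c0 (le_trans ct).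
by have := jacobian2_neq0 z (Pd c c01); rewrite -/(J c) Jc0 eqxx.
Qed.

End Jacobian.

(** * Transport of a front *)

Section Transport.
Variable R : realType.
Implicit Types (s t : R) (z u v : plane R).

Lemma reparametrization_is_derive (sg : R -> R) k t : reparametrization sg ->
  is_derive t (1 : R) (derive1n k sg) (derive1n k.+1 sg t).
Proof. by move=> [sgs _ _]; exact: smooth_is_derive. Qed.

Lemma reparametrization_continuous (sg : R -> R) : reparametrization sg -> continuous sg.
Proof. by move=> [sgs _ _] t; exact/differentiable_continuous/smooth_differentiable. Qed.

Lemma reparametrization_mono (sg : R -> R) : reparametrization sg ->
  {mono sg : s t / s < t}.
Proof.
move=> sgr; have [sgs _ sg0] := sgr; apply: leW_mono; apply: le_mono => s t st.
have [|c _] := @MVT_segment _ sg (derive1 sg) s t (ltW st) (fun c _ => reparametrization_is_derive 0 c sgr).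
  by apply: continuous_in_subspaceT => c _; exact: reparametrization_continuous.
by rewrite -subr_gt0 => ->; rewrite mulr_gt0 // subr_gt0.
Qed.

Lemma reparametrization_int (sg : R -> R) (k : int) t : reparametrization sg ->
  sg (t + k%:~R) = sg t + k%:~R.
Proof.
move=> [_ sg1 _]; have := @periodic_int R _ (fun t => sg t - t) k t.
move=> H; have {}H : sg (t + k%:~R) - (t + k%:~R) = sg t - t.
  by apply: H => s; rewrite sg1; ring.
by move: H => /(congr1 (fun x => x + (t + k%:~R))); rewrite subrK => ->; ring.
Qed.

(** The lift [sg] takes each value [sg 0 + k], hence every value between two of
    them. *)
Lemma reparametrization_surj (sg : R -> R) t : reparametrization sg ->
  exists s, sg s = t.
Proof.
move=> sgr; pose k := Num.floor (t - sg 0).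
have /andP[k0 k1] := floor_itv (t - sg 0); rewrite -/k in k0 k1.
have sE (m : int) : sg m%:~R = sg 0 + m%:~R by rewrite -[in LHS](add0r m%:~R) reparametrization_int.
have kk : (k%:~R : R) <= (k + 1)%:~R by rewrite ler_int lerDl.
have [||s _ <-] := @IVT R sg _ _ t kk; last by exists s.
- by apply: continuous_in_subspaceT => c _; exact: reparametrization_continuous.
- by rewrite !sE ge_min le_max; apply/andP; split; apply/orP; [left|right]; move: k0 k1; lra.
Qed.

Lemma same_param_reparam (sg : R -> R) s t : reparametrization sg ->
  same_param (sg s) (sg t) <-> same_param s t.
Proof.
move=> sgr; split=> -[k E]; exists k; last by rewrite E reparametrization_int.
move: E; rewrite -reparametrization_int // => E.
by case: (ltgtP s (t + k%:~R)) => //; rewrite -(reparametrization_mono sgr) E ltxx.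
Qed.

Lemma derive1n_fst (g : R -> plane R) k : smooth g ->
  derive1n k (fun t => (g t).1) = fun t => (derive1n k g t).1.
Proof.
move=> gs; elim: k => // k IH; rewrite derive1nS IH; apply/funext => t.
rewrite derive1E; apply: derive_val; apply: is_derive_fst; exact: smooth_is_derive.
Qed.

Lemma derive1n_snd (g : R -> plane R) k : smooth g ->
  derive1n k (fun t => (g t).2) = fun t => (derive1n k g t).2.
Proof.
move=> gs; elim: k => // k IH; rewrite derive1nS IH; apply/funext => t.
rewrite derive1E; apply: derive_val; apply: is_derive_snd; exact: smooth_is_derive.
Qed.

Variables (f : plane R -> plane R) (sg : R -> R) (F F' : front R).
Hypotheses (f_diffeo : diffeomorphism f) (sgr : reparametrization sg).
Hypothesis curveE : forall t, curve F' t = f (curve F (sg t)).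

Let f_diff z : differentiable f z.
Proof. by apply: smooth_differentiable; case: f_diffeo. Qed.

Let f_inj : injective f.
Proof. by case: f_diffeo => _ [g [_ fK _]]; exact: can_inj fK. Qed.

Lemma derive_neq0 z u : u != 0 -> 'D_u f z != 0.
Proof.
apply: contra => /eqP E; have := jacobian2_neq0 z f_diffeo.
have D v : jacobian2 f z * det2 u v = 0.
  by rewrite -det2_derive // E /det2 /= !mul0r subr0.
move=> J0; have := D (0, 1); have := D (1, 0); rewrite /det2 /= !mulr1 !mulr0 subr0 sub0r.
move=> /eqP; rewrite mulf_eq0 (negbTE J0) oppr_eq0 /= => /eqP u2.
move=> /eqP; rewrite mulf_eq0 (negbTE J0) /= => /eqP u1.
by case: u u1 u2 {E D} => a b /= -> ->.
Qed.

Lemma image_derive1 t :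
  derive1 (curve F') t = derive1 sg t *: 'D_(derive1 (curve F) (sg t)) f (curve F (sg t)).
Proof.
have gd : is_derive (sg t) (1 : R) (curve F) (derive1 (curve F) (sg t)).
  exact: (smooth_is_derive 0 (sg t) (curve_smooth F)).
have fgd := is_derive_chain (f_diff _) gd.
have sgd : is_derive t (1 : R) sg (derive1 sg t) := reparametrization_is_derive 0 t sgr.
have Fd : is_derive t (1 : R) (curve F') (derive1 (curve F') t).
  exact: (smooth_is_derive 0 t (curve_smooth F')).
have E : curve F' = (f \o curve F) \o sg by apply/funext.
have D1 : is_derive t (1 : R) (fun s => (curve F' s).1)
    (('D_(derive1 (curve F) (sg t)) f (curve F (sg t))).1 * derive1 sg t).
  by rewrite E; exact: (is_derive1_comp (is_derive_fst fgd) sgd).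
have D2 : is_derive t (1 : R) (fun s => (curve F' s).2)
    (('D_(derive1 (curve F) (sg t)) f (curve F (sg t))).2 * derive1 sg t).
  by rewrite E; exact: (is_derive1_comp (is_derive_snd fgd) sgd).
have E1 := etrans (esym (@derive_val _ _ _ _ _ _ _ (is_derive_fst Fd))) (@derive_val _ _ _ _ _ _ _ D1).
have E2 := etrans (esym (@derive_val _ _ _ _ _ _ _ (is_derive_snd Fd))) (@derive_val _ _ _ _ _ _ _ D2).
rewrite [LHS]surjective_pairing E1 E2 ![_ * derive1 sg t]mulrC.
by case: ('D_ _ f _).
Qed.

Lemma image_cusp t : cusp (curve F') t <-> cusp (curve F) (sg t).
Proof.
have [_ _ sg0] := sgr; rewrite /cusp image_derive1; split=> E; last first.
  by rewrite E derive0 scaler0.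
apply/eqP; apply: contraTT isT => /(derive_neq0 (curve F (sg t))).
by move/eqP: E; rewrite scaler_eq0 gt_eqF //= => ->.
Qed.

Lemma image_double t : double (curve F') t <-> double (curve F) (sg t).
Proof.
split=> [[s [st E]]|[s]].
  exists (sg s); rewrite same_param_reparam //; split=> //.
  by move: E; rewrite !curveE => /f_inj.
have [s' <-] := reparametrization_surj s sgr.
rewrite same_param_reparam // => -[st E]; exists s'; split=> //.
by rewrite !curveE E.
Qed.

Lemma image_singular t : singular F' t <-> singular F (sg t).
Proof. by rewrite /singular image_cusp image_double. Qed.

Lemma image_cusp_jets t : cusp (curve F) (sg t) ->
  let z := curve F (sg t) in
  derive1n 2 (curve F') t =
    'D_(derive1 sg t ^+ 2 *: derive1n 2 (curve F) (sg t)) f z /\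
  derive1n 3 (curve F') t =
    'D_((3 * derive1 sg t * derive1n 2 sg t) *: derive1n 2 (curve F) (sg t)
        + derive1 sg t ^+ 3 *: derive1n 3 (curve F) (sg t)) f z.
Proof.
move=> ct z; have [fs _] := f_diffeo.
have gd k s := @smooth_is_derive R _ _ k s (curve_smooth F).
have sd k s := reparametrization_is_derive k s sgr.
have J (phi : plane R -> R) : smooth phi ->
    jet3 ((phi \o curve F) \o sg) t 0
      (derive1 sg t ^+ 2 * 'D_(derive1n 2 (curve F) (sg t)) phi z)
      (3 * derive1 sg t * derive1n 2 sg t * 'D_(derive1n 2 (curve F) (sg t)) phi z
       + derive1 sg t ^+ 3 * 'D_(derive1n 3 (curve F) (sg t)) phi z).
  move=> phis; apply: (jet3_reparam (sd 0%N) (sd 1%N) (sd 2%N t)).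
  exact: (jet3_comp_critical phis (gd 0%N) (gd 1%N) (gd 2%N (sg t)) ct).
have [_ A2 A3] := jet3_derive1n (J _ (smooth_fst fs)).
have [_ B2 B3] := jet3_derive1n (J _ (smooth_snd fs)).
have E1 : (((fun y => (f y).1) \o curve F) \o sg) = (fun t => (curve F' t).1).
  by apply/funext => s; rewrite curveE.
have E2 : (((fun y => (f y).2) \o curve F) \o sg) = (fun t => (curve F' t).2).
  by apply/funext => s; rewrite curveE.
rewrite E1 in A2 A3; rewrite E2 in B2 B3.
set u := derive1n 2 (curve F) (sg t) in A2 A3 B2 B3 *.
set v := derive1n 3 (curve F) (sg t) in A3 B3 *.
clearbody u v.
have G1 k := congr1 (fun h => h t) (derive1n_fst k (curve_smooth F')).
have G2 k := congr1 (fun h => h t) (derive1n_snd k (curve_smooth F')).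
have D1 w := derive_fst w (f_diff z); have D2 w := derive_snd w (f_diff z).
have S c w : 'D_(c *: w) f z = c *: 'D_w f z.
  apply: (etrans (deriveE _ (f_diff z))); apply: (etrans (linearZ _ _)).
  exact: (congr1 _ (esym (deriveE _ (f_diff z)))).
have A c c' : 'D_(c *: u + c' *: v) f z = c *: 'D_u f z + c' *: 'D_v f z.
  apply: (etrans (deriveE _ (f_diff z))); apply: (etrans (linearD _ _ _)).
  by congr (_ + _); apply: (etrans (esym (deriveE _ (f_diff z)))).
rewrite (D1 u) in A2; rewrite (D2 u) in B2.
rewrite (D1 u) (D1 v) in A3; rewrite (D2 u) (D2 v) in B3.
rewrite S A.
move: ('D_u f z) ('D_v f z) A2 A3 B2 B3 => p q A2 A3 B2 B3.
have pairE (w : plane R) c d : w.1 = c -> w.2 = d -> w = (c, d) by case: w => ? ? /= -> ->.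
split; first exact: pairE (etrans (esym (G1 2%N)) A2) (etrans (esym (G2 2%N)) B2).
exact: pairE (etrans (esym (G1 3%N)) A3) (etrans (esym (G2 3%N)) B3).
Qed.

(** The term with the second derivative of [sg] in the third derivative of the image
    is a multiple of its second derivative and drops out of the determinant. *)
Lemma image_turns_left t : 0 < jacobian2 f (curve F (sg t)) ->
  cusp (curve F') t -> turns_left F' t <-> turns_left F (sg t).
Proof.
move=> Jpos ct'; have ct := (image_cusp t).1 ct'.
have [_ _ sg0] := sgr; have [E2 E3] := image_cusp_jets ct.
have dE (a b : plane R) : det2 (derive1 sg t ^+ 2 *: a)
    ((3 * derive1 sg t * derive1n 2 sg t) *: a + derive1 sg t ^+ 3 *: b) =
    derive1 sg t ^+ 5 * det2 a b.
  by rewrite /det2 /= /GRing.scale /=; ring.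
have S := etrans (congr2 (@det2 R) E2 E3) (etrans (det2_derive _ _ (f_diff _))
  (congr1 _ (dE _ _))).
suff H d d' : d' = jacobian2 f (curve F (sg t)) * (derive1 sg t ^+ 5 * d) -> d' < 0 <-> d < 0.
  exact: iff_trans (turns_left_det ct') (iff_trans (H _ _ S) (iff_sym (turns_left_det ct))).
by move=> ->; rewrite mulrA pmulr_rlt0 // mulr_gt0 // exprn_gt0.
Qed.

(** At a cusp the tangent is the second derivative, and the part of the chain rule
    with the second derivatives of [f] vanishes with the velocity. *)
Lemma image_tangent t : exists2 c, 0 < c &
  tangent (curve F') t = c *: 'D_(tangent (curve F) (sg t)) f (curve F (sg t)).
Proof.
have [_ _ sg0] := sgr; rewrite /tangent.
have -> : `[< cusp (curve F') t >] = `[< cusp (curve F) (sg t) >].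
  by apply/asboolP/asboolP; rewrite image_cusp.
case: asboolP => [ct|_]; last by exists (derive1 sg t); rewrite ?image_derive1.
exists (derive1 sg t ^+ 2); first by rewrite exprn_gt0.
apply: (etrans (proj1 (image_cusp_jets ct))).
apply: (etrans (deriveE _ (f_diff _))); apply: (etrans (linearZ _ _)).
exact: (congr1 _ (esym (deriveE _ (f_diff _)))).
Qed.

End Transport.
(** * The index and homotopies of direction fields *)

Section Index.
Variable R : realType.
Implicit Types (s t tau : R) (u v : R -> plane R).

(** The positive factor [rho] admits fields of arbitrary norm, as they occur along a
    homotopy. *)
Definition winding u (i : int) : Prop :=
  exists theta : R -> R, [/\ continuous theta,
    forall t, exists2 rho, 0 < rho & u t = (rho * cos (theta t), rho * sin (theta t)) &
    forall t, theta (t + 1) = theta t + i%:~R * (2 * pi)].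

Lemma is_index_winding (F : front R) i : is_index F i <-> winding (coor F) i.
Proof.
split=> -[theta [tc tE tp]]; exists theta; split=> // t.
  by exists 1; rewrite // !mul1r tE.
have [rho rho0 E] := tE t; have := coor_unit F t; rewrite E /dot /=.
have -> : rho * cos (theta t) * (rho * cos (theta t)) +
  rho * sin (theta t) * (rho * sin (theta t)) =
  rho ^+ 2 * (cos (theta t) ^+ 2 + sin (theta t) ^+ 2) by ring.
rewrite cos2Dsin2 mulr1 => /eqP; rewrite sqrf_eq1 => /orP[/eqP ->|/eqP rho1].
  by rewrite !mul1r.
by rewrite rho1 ltr0N1 in rho0.
Qed.

Lemma winding_scale u v i : (forall t, exists2 rho, 0 < rho & v t = rho *: u t) ->
  winding u i -> winding v i.
Proof.
move=> uv [theta [tc tE tp]]; exists theta; split=> // t.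
have [rho rho0 ->] := uv t; have [r r0 ->] := tE t.
by exists (rho * r); rewrite ?mulr_gt0 // -!mulrA.
Qed.

(** The oriented angle from [u] to [v] is less than a right angle, hence it is a
    continuous periodic function, the arc tangent of [det2 u v / dot u v]. *)
Lemma winding_acute u v i : continuous u -> continuous v ->
  (forall t, u (t + 1) = u t) -> (forall t, v (t + 1) = v t) ->
  (forall t, 0 < dot (u t) (v t)) -> winding u i -> winding v i.
Proof.
move=> uc vc up vp uv [theta [tc tE tp]].
pose a t := det2 (u t) (v t) / dot (u t) (v t).
have ac : continuous a.
  move=> t; apply: cvgM; first exact: continuous_det2.
  by apply: cvgV; [rewrite gt_eqF|exact: continuous_dot].
exists (fun t => theta t + atan (a t)); split=> [t|t|t]; last first.
- by rewrite tp /a up vp; ring.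
- have [rho rho0 E] := tE t; have d0 := uv t.
  have aE : a t * dot (u t) (v t) = det2 (u t) (v t) by rewrite /a divfK // gt_eqF.
  have c0 : 0 < cos (atan (a t)) by apply: cos_gt0_pihalf; rewrite atan_gtNpi2 atan_ltpi2.
  have sE : sin (atan (a t)) = a t * cos (atan (a t)).
    have : a t = sin (atan (a t)) / cos (atan (a t)) by rewrite -[LHS]atanK.
    by move: (atan (a t)) c0 => x c0 ->; rewrite divfK // gt_eqF.
  exists (dot (u t) (v t) / (rho * cos (atan (a t)))).
    by rewrite divr_gt0 // mulr_gt0.
  rewrite cosD sinD sE.
  have cs := cos2Dsin2 (theta t).
  move: d0 aE; rewrite E /dot /det2 /=; case: (v t) => v1 v2 /=.
  move: (cos (theta t)) (sin (theta t)) (a t) (cos (atan (a t))) c0 cs => c s al k k0 cs d0 aE.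
  have k1 : k != 0 by rewrite gt_eqF.
  have r1 : rho != 0 by rewrite gt_eqF.
  have s2 : s ^+ 2 = 1 - c ^+ 2 by rewrite -cs; ring.
  congr pair.
    have -> : (rho * c * v1 + rho * s * v2) / (rho * k) * (c * k - s * (al * k)) =
      (rho * c * v1 + rho * s * v2) / rho * c - al * (rho * c * v1 + rho * s * v2) / rho * s.
      by field; rewrite k1 r1.
    rewrite aE.
    have -> : (rho * c * v1 + rho * s * v2) / rho * c -
      (rho * c * v2 - rho * s * v1) / rho * s = v1 * (c ^+ 2 + s ^+ 2) by field.
    by rewrite cs mulr1.
  have -> : (rho * c * v1 + rho * s * v2) / (rho * k) * (s * k + c * (al * k)) =
    (rho * c * v1 + rho * s * v2) / rho * s + al * (rho * c * v1 + rho * s * v2) / rho * c.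
    by field; rewrite k1 r1.
  rewrite aE.
  have -> : (rho * c * v1 + rho * s * v2) / rho * s +
    (rho * c * v2 - rho * s * v1) / rho * c = v2 * (c ^+ 2 + s ^+ 2) by field.
  by rewrite cs mulr1.
- apply: cvgD; first exact: tc.
  by apply: (@continuous_comp _ _ _ a (@atan R) t); [exact: ac|exact: continuous_atan].
Qed.

Lemma dotC (p q : plane R) : dot p q = dot q p.
Proof. by rewrite /dot; ring. Qed.

Lemma dot_gt0 (p : plane R) : p != 0 -> 0 < dot p p.
Proof.
case: p => a b; rewrite /dot /= => ab; rewrite lt_neqAle addr_ge0 -?expr2 ?sqr_ge0 // andbT.
rewrite eq_sym paddr_eq0 ?sqr_ge0 // !sqrf_eq0; apply: contra ab => /andP[/eqP -> /eqP ->].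
by [].
Qed.

(** The indicator function of [P] is continuous and takes no intermediate value. *)
Lemma locally_constant (P : R -> Prop) :
  (forall x : R, 0 <= x <= 1 -> \forall y \near x, P y <-> P x) -> P 0 <-> P 1.
Proof.
move=> loc; pose c x : R := if `[< P x >] then 1 else 0.
have cc : {within `[0, 1], continuous c}.
  apply: continuous_in_subspaceT => x; rewrite inE /= in_itv /= => x01.
  apply: cvg_near_cst; apply: filterS (loc x x01) => y Pxy.
  by rewrite /c; congr (if _ then _ else _); apply/asboolP/asboolP => /Pxy.
have half : Num.min (c 0) (c 1) <= 2^-1 <= Num.max (c 0) (c 1) -> False.
  move=> H; have [x _] := IVT ler01 cc H.
  by rewrite /c; case: ifP => _; lra.
by split=> H; apply: contrapT => nH; apply: half; rewrite /c (asboolT H) (asboolF nH);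
   rewrite ge_min le_max; apply/andP; split; apply/orP; ((left; lra) || (right; lra)).
Qed.

(** Homotopic nowhere zero periodic fields have the same winding numbers: nearby
    fields of the homotopy make an acute angle everywhere, by compactness of a
    period, so that the winding numbers are locally constant along it. *)
Lemma winding_homotopy (H : R * R -> plane R) i :
  continuous H -> (forall tau t, H (tau, t + 1) = H (tau, t)) ->
  (forall tau t, 0 <= tau <= 1 -> H (tau, t) != 0) ->
  winding (fun t => H (0, t)) i <-> winding (fun t => H (1, t)) i.
Proof.
move=> Hc Hp H0; apply: (@locally_constant (fun tau => winding (fun t => H (tau, t)) i)) => tau tau01.
have Hsc s : continuous (fun t => H (s, t)).
  move=> t; apply: (@continuous_comp _ _ _ (fun x => (s, x)) H t); last exact: Hc.
  by apply: continuous_pair => r; [exact: cvg_cst|exact: cvg_id].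
have acute : \forall s \near tau, forall t, 0 < dot (H (tau, t)) (H (s, t)).
  have /compact_near_coveringP cover := @segment_compact R 0 1.
  have : \forall s \near tau, `[0, 1]%classic `<=` (fun t => 0 < dot (H (tau, t)) (H (s, t))).
    apply: (cover R (nbhs tau) (fun s t => 0 < dot (H (tau, t)) (H (s, t)))) => x _.
    pose d (w : R * R) := dot (H (tau, w.1)) (H (w.2, w.1)).
    have dc : continuous d.
      apply: continuous_dot => w.
        apply: (@continuous_comp _ _ _ (fun w : R * R => w.1) (fun t => H (tau, t)) w); last exact: Hsc.
        exact: cvg_fst.
      apply: (@continuous_comp _ _ _ (fun w : R * R => (w.2, w.1)) H w); last exact: Hc.
      by apply: continuous_pair => z; [exact: cvg_snd|exact: cvg_fst].
    have := cvgr_gt _ (dc (x, tau)); apply.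
    by apply: dot_gt0; apply: H0.
  apply: filterS => s Hs t; have /andP[k0 k1] := floor_itv t.
  have E r : H (r, t) = H (r, t - (Num.floor t)%:~R).
    by rewrite -rmorphN (@periodic_int _ _ (fun t => H (r, t))).
  rewrite !E; apply: Hs; rewrite /= in_itv /=.
  by rewrite intrD in k1; apply/andP; split; move: k0 k1; lra.
apply: filterS acute => s acute.
split; apply: winding_acute => // t; last by rewrite dotC.
Qed.

End Index.
(** * Invariance under plane isotopy *)

Section Isotopy.
Variable R : realType.
Implicit Types (F : front R) (s t : R).

Lemma tangent_neq0 F t : tangent (curve F) t != 0.
Proof.
rewrite /tangent; case: asboolP => [ct|/eqP //].
apply: contraNneq (curve_semicubical ct) => ->.
by rewrite /det2 /= !mul0r subr0.
Qed.

(** For a linear map with columns [p] and [q] and determinant [d], this is [d]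
    times the image of the covector [n] under the inverse transpose: it is normal
    to the image of the kernel of [n]. *)
Definition conormal (p q n : plane R) : plane R :=
  (n.1 * q.2 - n.2 * p.2, n.2 * p.1 - n.1 * q.1).

Lemma dot_conormal (p q n u : plane R) :
  dot (conormal p q n) (u.1 *: p + u.2 *: q) = det2 p q * dot n u.
Proof. by rewrite /dot /det2 /conormal /= /GRing.scale /=; ring. Qed.

Lemma continuous_conormal (T : topologicalType) (p q n : T -> plane R) :
  continuous p -> continuous q -> continuous n ->
  continuous (fun x => conormal (p x) (q x) (n x)).
Proof.
move=> pc qc nc; apply: continuous_pair => x; apply: cvgB; apply: cvgM.
- exact: continuous_fst_comp.
- exact: continuous_snd_comp.
- exact: continuous_snd_comp.
- exact: continuous_snd_comp.
- exact: continuous_snd_comp.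
- exact: continuous_fst_comp.
- exact: continuous_fst_comp.
- exact: continuous_fst_comp.
Qed.

Lemma dotZr (c : R) (m w : plane R) : dot m (c *: w) = c * dot m w.
Proof. by rewrite /dot /= /GRing.scale /=; ring. Qed.

(** Two vectors normal to the same nonzero vector are proportional, and the image of
    [n] is on the positive side of both. *)
Lemma conormal_direction (p q n v m : plane R) : 0 < det2 p q -> dot n n = 1 ->
  dot n v = 0 -> v != 0 -> dot m (v.1 *: p + v.2 *: q) = 0 ->
  0 < dot m (n.1 *: p + n.2 *: q) ->
  exists2 rho, 0 < rho & m = rho *: conormal p q n.
Proof.
set d := det2 p q; set c := dot m (n.1 *: _ + _) => d0 nn nv v0 mv c0.
exists (c / d); first by rewrite divr_gt0.
have dn : d != 0 by rewrite gt_eqF.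
(* [n] has norm 1, so [v] is a multiple of the quarter turn of [n]. *)
pose k := n.1 * v.2 - n.2 * v.1.
have vE : v.1 = - k * n.2 /\ v.2 = k * n.1.
  have e1 : v.1 = - k * n.2 + n.1 * dot n v + (1 - dot n n) * v.1.
    by rewrite /k /dot; ring.
  have e2 : v.2 = k * n.1 + n.2 * dot n v + (1 - dot n n) * v.2.
    by rewrite /k /dot; ring.
  by rewrite {1}e1 {1}e2 nv nn subrr !mulr0 !mul0r !addr0.
have k0 : k != 0.
  apply: contra v0 => /eqP k0; rewrite k0 oppr0 !mul0r in vE.
  by case: v vE {nv mv k k0} => a b /= [-> ->].
have ab : n.1 * dot m q = n.2 * dot m p.
  have : k * (n.1 * dot m q - n.2 * dot m p) = 0.
    by rewrite -mv (proj1 vE) (proj2 vE) /dot /= /GRing.scale /=; ring.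
  by move/eqP; rewrite mulf_eq0 (negbTE k0) /= subr_eq0 => /eqP.
have cE : c = n.1 * dot m p + n.2 * dot m q.
  by rewrite /c /dot /= /GRing.scale /=; ring.
have aE : dot m p = c * n.1.
  have -> : dot m p = c * n.1 + n.2 * (n.2 * dot m p - n.1 * dot m q) + (1 - dot n n) * dot m p.
    by rewrite cE [dot n n]/dot; ring.
  by rewrite ab nn !subrr mulr0 mul0r !addr0.
have bE : dot m q = c * n.2.
  have -> : dot m q = c * n.2 + n.1 * (n.1 * dot m q - n.2 * dot m p) + (1 - dot n n) * dot m q.
    by rewrite cE [dot n n]/dot; ring.
  by rewrite ab nn !subrr mulr0 mul0r !addr0.
have m1 : d * m.1 = dot m p * q.2 - dot m q * p.2 by rewrite /d /dot /det2; ring.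
have m2 : d * m.2 = dot m q * p.1 - dot m p * q.1 by rewrite /d /dot /det2; ring.
rewrite [LHS]surjective_pairing -[m.1](mulKf dn) -[m.2](mulKf dn) m1 m2 aE bE.
by congr pair; rewrite /= /GRing.scale /=; ring.
Qed.

(** The homotopy follows the isotopy and at the same time deforms the parameter
    from the identity to [sg], by the affine paths [par]. *)
Lemma image_index F F' (Phi : R * plane R -> plane R) i :
  ambient_isotopy Phi -> front_image (fun z => Phi (1, z)) F F' ->
  is_index F i <-> is_index F' i.
Proof.
move=> iso [sg [sgr curveE coorE]].
have [Ps P0 Pd] := iso.
have f_diffeo : diffeomorphism (fun z => Phi (1, z)) by apply: Pd; rewrite ler01 lexx.
have f_diff z : differentiable (fun z => Phi (1, z)) z.
  by apply: smooth_differentiable; case: f_diffeo.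
pose par (w : R * R) := (1 - w.1) * w.2 + w.1 * sg w.2.
pose P (w : R * R) := 'D_(0, (1, 0)) Phi (w.1, curve F (par w)).
pose Q (w : R * R) := 'D_(0, (0, 1)) Phi (w.1, curve F (par w)).
pose n (w : R * R) := coor F (par w).
pose H w := conormal (P w) (Q w) (n w).
have fstc : continuous (fun w : R * R => w.1) by move=> w; exact: cvg_fst.
have sndc : continuous (fun w : R * R => w.2) by move=> w; exact: cvg_snd.
have sgc := reparametrization_continuous sgr.
have parc : continuous par.
  move=> w; apply: cvgD; apply: cvgM.
  - by apply: cvgB; [exact: cvg_cst|exact: fstc].
  - exact: sndc.
  - exact: fstc.
  - by apply: (@continuous_comp _ _ _ (fun w : R * R => w.2) sg w); [exact: sndc|exact: sgc].
have gammac : continuous (fun w => (w.1, curve F (par w)) : R * plane R).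
  apply: continuous_pair => // w.
  apply: (@continuous_comp _ _ _ par (curve F) w); first exact: parc.
  exact: (differentiable_continuous (smooth_differentiable _ (curve_smooth F))).
have Pc : continuous P by exact: smooth_derive_continuous.
have Qc : continuous Q by exact: smooth_derive_continuous.
have nc : continuous n.
  by move=> w; apply: (@continuous_comp _ _ _ par (coor F) w); [exact: parc|exact: coor_continuous].
have Hc : continuous H := continuous_conormal Pc Qc nc.
have par1 tau t : par (tau, t + 1) = par (tau, t) + 1.
  by rewrite /par /=; case: sgr => _ -> _; ring.
have Hp tau t : H (tau, t + 1) = H (tau, t).
  by rewrite /H /P /Q /n /= !par1 curve_periodic coor_periodic.
have detPQ tau t : 0 <= tau <= 1 -> 0 < det2 (P (tau, t)) (Q (tau, t)).
  move=> tau01; have := isotopy_jacobian_gt0 (curve F (par (tau, t))) iso tau01.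
  by rewrite /jacobian2 !isotopy_derive.
have H0 tau t : 0 <= tau <= 1 -> H (tau, t) != 0.
  move=> tau01; have Dpos := detPQ tau t tau01.
  have := dot_conormal (P (tau, t)) (Q (tau, t)) (n (tau, t)) (n (tau, t)).
  rewrite coor_unit mulr1 => E; apply/eqP => H0; move: E Dpos.
  by rewrite -/(H (tau, t)) H0 [dot 0 _]/dot /= !mul0r addr0 => <-; rewrite ltxx.
have parE0 t : par (0, t) = t by rewrite /par /=; ring.
have parE1 t : par (1, t) = sg t by rewrite /par /=; ring.
have start t : H (0, t) = coor F t.
  have E u : 'D_(0, u) Phi (0, curve F t) = u.
    rewrite -isotopy_derive; have -> : (fun w => Phi (0, w)) = (fun w => w) by apply/funext.
    exact: derive_id_plane.
  rewrite /H /P /Q /n /= parE0 !E /conormal /= !mulr1 !mulr0 subr0 subr0.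
  by case: (coor F t).
have finish t : exists2 rho, 0 < rho & coor F' t = rho *: H (1, t).
  have [c c0 TE] := image_tangent f_diffeo sgr curveE t.
  have PE : P (1, t) = 'D_(1, 0) (fun z => Phi (1, z)) (curve F (sg t)) :=
    etrans (congr1 (fun s => 'D_(0, (1, 0)) Phi (1, curve F s)) (parE1 t))
      (esym (isotopy_derive _ _ _ _)).
  have QE : Q (1, t) = 'D_(0, 1) (fun z => Phi (1, z)) (curve F (sg t)) :=
    etrans (congr1 (fun s => 'D_(0, (0, 1)) Phi (1, curve F s)) (parE1 t))
      (esym (isotopy_derive _ _ _ _)).
  have DE u : 'D_u (fun z => Phi (1, z)) (curve F (sg t)) = u.1 *: P (1, t) + u.2 *: Q (1, t) :=
    etrans (derive_plane u (f_diff _))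
      (congr2 (fun p q => u.1 *: p + u.2 *: q) (esym PE) (esym QE)).
  apply: (@conormal_direction _ _ _ (tangent (curve F) (sg t))).
  - by apply: detPQ; rewrite ler01 lexx.
  - exact: coor_unit.
  - by rewrite /n parE1 coor_normal.
  - exact: tangent_neq0.
  - have := coor_normal F' t; rewrite TE DE => /(etrans (esym (dotZr _ _ _)))/eqP.
    by rewrite mulf_eq0 (gt_eqF c0) => /eqP.
  - by have := coorE t; rewrite DE /n parE1.
have start' : (fun t => H (0, t)) = coor F by apply/funext.
rewrite !is_index_winding -start'.
apply: (iff_trans (winding_homotopy i Hc Hp H0)); split; apply: winding_scale => t.
  exact: finish.
have [rho rho0 E] := finish t; exists rho^-1; first by rewrite invr_gt0.
by rewrite E scalerA mulVf ?scale1r // gt_eqF.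
Qed.

(** The other passage through a double point also lies strictly within the period
    from [b], because [b] itself is not on a double point. *)
Lemma single_passage_cusp F b t A : base_point F b ->
  times_at F b A = [:: t] -> cusp (curve F) t.
Proof.
move=> nb E; have : t \in times_at F b A by rewrite E mem_head.
rewrite mem_filter => /andP[/eqP tA tT].
have [/andP[bt tb] [//|[s [st Es]]]] := sing_times_sub tT.
have fin : finite_set (sing_set F b).
  apply: contrapT => /sing_times_infinite nil; by rewrite nil in tT.
pose k := Num.floor (s - b); pose s' := s + (- k)%:~R.
have /andP[k0 k1] := floor_itv (s - b); rewrite -/k in k0 k1.
have Es' : curve F s' = A by rewrite curve_shift Es.
have st' : ~ same_param s' t by rewrite same_param_shift.
have ss : singular F s' by right; exists t; split; [move/same_param_sym | rewrite Es'].
suff sT : s' \in sing_times F b.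
  have : s' \in times_at F b A by rewrite mem_filter Es' eqxx.
  by rewrite E inE => /eqP s't; case: st'; rewrite s't; exists 0; rewrite addr0.
apply/(mem_sing_times s' fin); split=> //.
have sb : s' != b by apply: contra_not_neq nb => <-.
rewrite lt_neqAle eq_sym sb /= /s' rmorphN /=.
by rewrite intrD in k1; apply/andP; split; move: k0 k1; lra.
Qed.

(** The passages through the singularities correspond under [sg], the letters under
    the diffeomorphism, and the signs agree because its Jacobian is positive. *)
Lemma image_pairing F F' (Phi : R * plane R -> plane R) b b' v :
  ambient_isotopy Phi -> front_image (fun z => Phi (1, z)) F F' ->
  base_point F b -> base_point F' b' ->
  front_pairing F b v = front_pairing F' b' v.
Proof.
move=> iso [sg [sgr curveE coorE]] nb nb'.
have [Ps P0 Pd] := iso.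
have one01 : 0 <= (1 : R) <= 1 by rewrite ler01 lexx.
have f_diffeo := Pd 1 one01.
have f_diff z : differentiable (fun z => Phi (1, z)) z.
  by apply: smooth_differentiable; case: f_diffeo.
have f_inj : injective (fun z => Phi (1, z)).
  by case: f_diffeo => _ [g [_ fK _]]; exact: can_inj fK.
have sing t : singular F (sg t) <-> singular F' t.
  exact: iff_sym (image_singular f_diffeo sgr curveE t).
have nsb : base_point F (sg b') by rewrite /base_point sing.
have [_ sg1 sg0] := sgr.
rewrite (front_pairing_base v nb nsb) !front_pairingE /front_word.
have TE : sing_times F (sg b') = map sg (sing_times F' b').
  apply: sing_times_map => //; first exact: reparametrization_mono.
  by move=> t; exact: reparametrization_surj.
have -> : [seq curve F' t | t <- sing_times F' b'] =
    map (fun z => Phi (1, z)) [seq curve F t | t <- sing_times F (sg b')].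
  by rewrite TE -!map_comp; apply: eq_map => t /=; rewrite curveE.
apply: esym; apply: bracket_pairing_map; [exact: f_inj|move=> A _; rewrite !letter_signE].
have -> : times_at F (sg b') A = map sg (times_at F' b' (Phi (1, A))).
  rewrite /times_at TE filter_map; congr map; apply: eq_filter => t /=.
  by rewrite curveE (inj_eq f_inj).
have := @single_passage_cusp F' b' _ (Phi (1, A)) nb'.
have : forall t, t \in times_at F' b' (Phi (1, A)) -> curve F (sg t) = A.
  by move=> t; rewrite mem_filter curveE => /andP[/eqP /f_inj].
case: (times_at F' b' (Phi (1, A))) => [|s [|t L]] tA cs; first by [].
  have := image_turns_left f_diffeo sgr curveE (isotopy_jacobian_gt0 _ iso one01) (cs s erefl).
  move=> E; apply: (congr1 (fun c : bool => (if c then -1 else 1) : int)).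
  by apply/asboolP/asboolP => /E.
have J0 := isotopy_jacobian_gt0 A iso one01.
have D r : r \in [:: s, t & L] -> derive1 (curve F') r =
    derive1 sg r *: 'D_(derive1 (curve F) (sg r)) (fun z => Phi (1, z)) A.
  by move=> rL; rewrite (image_derive1 f_diffeo sgr curveE) tA.
suff S : det2 (derive1 (curve F') s) (derive1 (curve F') t) =
    (derive1 sg s * derive1 sg t * jacobian2 (fun z => Phi (1, z)) A) *
    det2 (derive1 (curve F) (sg s)) (derive1 (curve F) (sg t)).
  have S' (d d' : R) : d' = (derive1 sg s * derive1 sg t *
      jacobian2 (fun z => Phi (1, z)) A) * d -> (d' < 0) = (d < 0).
    by move=> ->; rewrite pmulr_rlt0 // !mulr_gt0.
  exact: (congr1 (fun c : bool => (if c then 1 else -1) : int) (S' _ _ S)).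
have Ds := D s (mem_head _ _).
have tL : t \in [:: s, t & L] by rewrite !inE eqxx orbT.
have Dt := D t tL.
apply: (etrans (congr2 (@det2 R) Ds Dt)).
have dE (c c' : R) (p q : plane R) : det2 (c *: p) (c' *: q) = c * c' * det2 p q.
  by rewrite /det2 /= /GRing.scale /=; ring.
apply: (etrans (dE _ _ _ _)); apply: (etrans _ (mulrA _ _ _)).
exact: (congr1 _ (det2_derive _ _ (f_diff A))).
Qed.

End Isotopy.

Theorem theorem5p4 (R : realType) (A : comNzRingType) (x y p q r s t : A) :
  (forall (F : front R) (b b' : R),
     base_point F b -> base_point F b' ->
     FI3 F b x y p q r s t = FI3 F b' x y p q r s t) /\
  (forall (F F' : front R) (b b' : R),
     plane_isotopic F F' -> base_point F b -> base_point F' b' ->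
     FI3 F b x y p q r s t = FI3 F' b' x y p q r s t).
Proof.
split=> [F b b' nb nb'|F F' b b' [Phi [iso im]] nb nb'].
  by rewrite /FI3 !(front_pairing_base _ nb nb').
have iE : index_front F = index_front F'.
  rewrite /index_front; congr (xget 0 _).
  by apply/funext => i; apply/propext; exact: image_index iso im.
have pE v : front_pairing F b v = front_pairing F' b' v := image_pairing v iso im nb nb'.
by rewrite /FI3 iE !pE.
Qed.
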